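(* Let $(X,\mu),(Y,\nu),(X_1,\mu_1),(Y_1,\nu_1)$ be standard measure spaces, and let $\theta:X\to X_1$ and $\rho:Y\to Y_1$ be Borel mappings such that $\theta_*(\mu)$ is absolutely continuous with respect to $\mu_1$ and $\rho_*(\nu)$ is absolutely continuous with respect to $\nu_1$. Let $E_1$ be a Borel subset of $X_1\times Y_1$ and $E=(\theta\times\rho)^{-1}(E_1)$. If a nonzero compact operator (respectively a nonzero finite rank operator, respectively a rank 1 operator) is supported on $E$, then a nonzero compact operator (respectively a nonzero finite rank operator, respectively a rank 1 operator) is supported on $E_1$. Also, if $\mathfrak M_{min}(E)$ contains a nonzero compact operator (respectively a nonzero finite rank operator, respectively a rank 1 operator), then so does $\mathfrak M_{min}(E_1)$.
   Context: Standard measure spaces $(X,\mu)$, $(Y,\nu)$: the measures are regular Borel measures with respect to Borel structures arising from complete (separable) metrizable topologies, as usual $\sigma$-finite. $\theta_*(\mu)(\alpha)=\mu(\theta^{-1}(\alpha))$ and $\rho_*(\nu)(\beta)=\nu(\rho^{-1}(\beta))$ for Borel sets $\alpha\subset X_1$, $\beta\subset Y_1$. Let $H_1=L^2(X,\mu)$, $H_2=L^2(Y,\nu)$; $M_\phi$ denotes the operator of multiplication by the $L^\infty$ function $\phi$; $\chi_\gamma$ is the characteristic function of $\gamma$; $\mathcal D_1=\{M_\phi:\phi\in L^\infty(X,\mu)\}$, $\mathcal D_2=\{M_\psi:\psi\in L^\infty(Y,\nu)\}$ are maximal abelian selfadjoint algebras (masas). A subset of $X\times Y$ is marginally null if it is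 contained in $(M_1\times Y)\cup(X\times M_2)$ with $\mu(M_1)=\nu(M_2)=0$; two subsets are marginally equivalent ($\cong$) if their symmetric difference is marginally null. An operator $T\in B(H_1,H_2)$ is supported on $\sigma\subset X\times Y$ if $M_{\chi_\beta}TM_{\chi_\alpha}=0$ for all measurable $\alpha\subset X,\beta\subset Y$ with $(\alpha\times\beta)\cap\sigma\cong\emptyset$. $\mathfrak M_{max}(\sigma)$ is the set of all $T\in B(H_1,H_2)$ supported on $\sigma$; it is a reflexive $\mathcal D_2$-$\mathcal D_1$ bimodule. For a subspace $\mathcal U\subset B(H_1,H_2)$, $\mathrm{Ref}(\mathcal U)=\{T: T\xi\in\overline{\mathrm{span}(\mathcal U\xi)}\ \forall\xi\in H_1\}$. For a weak* closed $\mathcal D_2$-$\mathcal D_1$ bimodule $\mathcal U$, $\mathcal U_{min}$ is the smallest weak* closed $\mathcal D_2$-$\mathcal D_1$ bimodule contained in $\mathcal U$ with $\mathrm{Ref}(\mathcal U_{min})=\mathrm{Ref}(\mathcal U)$. $\mathfrak M_{min}(\sigma)=(\mathfrak M_{max}(\sigma))_{min}$. The same notions are used for $X_1\times Y_1$ with $\mu_1,\nu_1$. *)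

(* Defs.v *)
From HB Require Import structures.
From mathcomp Require Import all_boot all_order all_algebra.
From mathcomp Require Import complex ring.
From mathcomp Require Import all_classical all_reals all_analysis.
From mathcomp Require Import measurable_realfun ess_sup_inf.

Set Implicit Arguments.
Unset Strict Implicit.
Unset Printing Implicit Defensive.
Import Order.TTheory GRing.Theory Num.Theory.
Import numFieldNormedType.Exports.
Local Open Scope classical_set_scope.
Local Open Scope ring_scope.

HB.instance Definition _ (R : realType) := GRing.ComAlgebra.copy R[i] R[i]^o.
HB.instance Definition _ (R : realType) := NormedModule.copy R[i] R[i]^o.

#[short(type="completeMetricType")]
HB.structure Definition CompleteMetric (R : realType) :=
  {T of CompletePseudoMetric R T & PseudoMetric_isMetric R T}.

Section L2_functions.
Context d (T : measurableType d) (R : realType).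
Variable mu : {measure set T -> \bar R}.
Local Notation C := R[i].

Definition cabs (z : C) : R := complex.Re `|z|.

Definition cLfun (p : \bar R) (f : T -> C) : Prop :=
  (@complex.Re R \o f) \in Lfun mu p /\ (@complex.Im R \o f) \in Lfun mu p.

Definition L2fun : {pred T -> C} := mem [set f | cLfun 2%:E f].

Lemma L2fun_submod_closed : submod_closed L2fun.
Proof.
have [Z0 ZD] := Lfun_submod_closed mu (@lee1n R 2).
split=> [|a f g].
  rewrite inE; split; exact: Z0.
rewrite !inE => -[f1 f2] [g1 g2]; split.
  have -> : (@complex.Re R \o (a *: f + g)) =
    complex.Re a *: (@complex.Re R \o f) + (- complex.Im a *: (@complex.Im R \o f) +  (@complex.Re R \o g)).
    apply/funext => x; rewrite /= !fctE.
    change (complex.Re (a * f x + g x) = complex.Re a * complex.Re (f x) + (- complex.Im a * complex.Im (f x) + complex.Re (g x))).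
    case: a (f x) (g x) => [a b] [c e] [h k] /=.
    ring.
  by apply: (ZD) => //; apply: (ZD).
have -> : (@complex.Im R \o (a *: f + g)) =
    complex.Re a *: (@complex.Im R \o f) + (complex.Im a *: (@complex.Re R \o f) +  (@complex.Im R \o g)).
  apply/funext => x; rewrite /= !fctE.
    change (complex.Im (a * f x + g x) = complex.Re a * complex.Im (f x) + (complex.Im a * complex.Re (f x) + complex.Im (g x))).
  case: a (f x) (g x) => [a b] [c e] [h k] /=.
  ring.
by apply: (ZD) => //; apply: (ZD).
Qed.

HB.instance Definition _ := GRing.isSubmodClosed.Build _ _ L2fun
  L2fun_submod_closed.

Definition L2fun_type := {f : T -> C | f \in L2fun}.
HB.instance Definition _ := SubChoice.on L2fun_type.
HB.instance Definition _ := [SubChoice_isSubLmodule of L2fun_type by <:].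

Definition L2null : {pred L2fun_type} := mem [set f | \val f = cst 0 %[ae mu]].

Lemma L2null_submod_closed : submod_closed L2null.
Proof.
split=> [|a f g].
  by rewrite inE; exact: ae_eq_refl.
rewrite !inE /= => f0 g0.
apply: filterS2 f0 g0 => x /= f0 g0 _.
by rewrite !fctE f0// g0// scaler0 addr0.
Qed.
HB.instance Definition _ := GRing.isSubmodClosed.Build _ _ L2null
  L2null_submod_closed.

Local Open Scope quotient_scope.
Definition L2 := Quotient.quot L2null.
HB.instance Definition _ := GRing.Zmodule.on L2.
HB.instance Definition _ := EqQuotient.on L2.

Lemma L2_eqP (f g : L2fun_type) :
  \pi_L2 f = \pi_L2 g <-> \val f = \val g %[ae mu].
Proof.
split.
  move/eqP; rewrite -Quotient.idealrBE inE /= => fg.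
  by apply: filterS fg => x /= fg _; apply/eqP; rewrite -subr_eq0; apply/eqP/fg.
move=> fg; apply/eqP; rewrite -Quotient.idealrBE inE /=.
by apply: filterS fg => x /= fg _; rewrite !fctE fg// subrr.
Qed.

Definition L2scale (a : C) (u : L2) : L2 := \pi_L2 (a *: repr u).

Lemma repr_pi_ae (f : L2fun_type) : \val (repr (\pi_L2 f)) = \val f %[ae mu].
Proof. by apply/L2_eqP; rewrite reprK. Qed.

Lemma L2scale_pi a f : L2scale a (\pi_L2 f) = \pi_L2 (a *: f).
Proof.
apply/L2_eqP; apply: filterS (repr_pi_ae f) => x /= E _.
by rewrite !fctE E.
Qed.

Lemma L2piD f g : \pi_L2 (f + g) = \pi_L2 f + \pi_L2 g.
Proof. exact: raddfD. Qed.

Let L2scaleA a b u : L2scale a (L2scale b u) = L2scale (a * b) u.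
Proof. by rewrite -[u]reprK !L2scale_pi ?reprK scalerA. Qed.
Let L2scale1 : left_id 1 L2scale.
Proof. by move=> u; rewrite -[u]reprK !L2scale_pi scale1r. Qed.
Let L2scaleDr : right_distributive L2scale +%R.
Proof.
by move=> a u v; rewrite -[u]reprK -[v]reprK -L2piD !L2scale_pi scalerDr L2piD.
Qed.
Let L2scaleDl u : {morph L2scale^~ u : a b / a + b}.
Proof. by move=> a b; rewrite -[u]reprK !L2scale_pi scalerDl L2piD. Qed.

HB.instance Definition _ := GRing.Zmodule_isLmodule.Build C L2
  L2scaleA L2scale1 L2scaleDr L2scaleDl.

Lemma cabsE z : cabs z = Num.sqrt (complex.Re z ^+ 2 + complex.Im z ^+ 2).
Proof. by rewrite /cabs normc_def. Qed.

Lemma cabs_ge0 z : 0 <= cabs z.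
Proof. by rewrite cabsE sqrtr_ge0. Qed.

Lemma cabsC z : (cabs z)%:C%C = `|z|.
Proof. by rewrite cabsE normc_def. Qed.

Lemma cabsD z w : cabs (z + w) <= cabs z + cabs w.
Proof. by rewrite -lecR rmorphD/= !cabsC ler_normD. Qed.

Lemma cabsM z w : cabs (z * w) = cabs z * cabs w.
Proof. by apply: (@complexI R); rewrite rmorphM/= !cabsC normrM. Qed.

Lemma cabs_eq0 z : cabs z = 0 -> z = 0.
Proof. by move=> z0; apply/eqP; rewrite -normr_eq0 -cabsC z0. Qed.

Lemma cabs_le z : cabs z <= `|complex.Re z| + `|complex.Im z|.
Proof.
rewrite cabsE -(ger0_norm (addr_ge0 (normr_ge0 _) (normr_ge0 _))) -sqrtr_sqr.
rewrite ler_sqrt ?sqr_ge0// sqrrD !real_normK ?num_real//.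
by rewrite lerD2r lerDl mulrn_wge0// mulr_ge0.
Qed.

Lemma measurable_cabs (f : T -> C) :
  measurable_fun setT (@complex.Re R \o f) ->
  measurable_fun setT (@complex.Im R \o f) ->
  measurable_fun setT (cabs \o f).
Proof.
move=> mf mg.
have -> : cabs \o f = Num.sqrt \o
    ((fun x => ((@complex.Re R \o f) x) ^+ 2) \+
     (fun x => ((@complex.Im R \o f) x) ^+ 2)).
  by apply/funext => x /=; rewrite cabsE.
apply: measurableT_comp.
  by apply: continuous_measurable_fun; exact: sqrt_continuous.
by apply: measurable_funD; exact: measurable_funX.
Qed.

Let mp (h : T -> R) : measurable_fun setT h ->
  measurable_fun setT (fun x => (`|(EFin \o h) x| `^ 2)%E).
Proof.
move=> mh.
have -> : (fun x => (`|(EFin \o h) x| `^ 2)%E) = EFin \o (fun x => (h x) ^+ 2).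
  apply/funext => x; rewrite /comp abse_EFin poweR_EFin powR_mulrn// real_normK//.
  exact: num_real.
by apply/measurable_EFinP; exact: measurable_funX.
Qed.

Lemma le_Lnorm2 (f g : T -> R) :
  measurable_fun setT f -> measurable_fun setT g ->
  (forall x, 0 <= f x <= g x) ->
  ('N[mu]_2[EFin \o f] <= 'N[mu]_2[EFin \o g])%E.
Proof.
move=> mf mg fg; rewrite unlock.
apply: gt0_ler_poweR.
- by rewrite invr_ge0.
- by rewrite in_itv/= leey andbT integral_ge0// => x _; exact: poweR_ge0.
- by rewrite in_itv/= leey andbT integral_ge0// => x _; exact: poweR_ge0.
apply: ge0_le_integral => //=; try exact: mp; try by move=> x _; exact: poweR_ge0.
move=> x _; have /andP[f0 fgx] := fg x.
rewrite lee_fin ge0_ler_powR ?nnegrE//.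
by rewrite !ger0_norm// (le_trans f0).
Qed.

Lemma L2fun_measurable (f : L2fun_type) :
  measurable_fun setT (@complex.Re R \o \val f) /\
  measurable_fun setT (@complex.Im R \o \val f).
Proof.
case: f => f /=; rewrite inE => -[/andP[+ _] /andP[+ _]].
by rewrite !inE.
Qed.

Lemma measurable_cabs_L2 (f : L2fun_type) : measurable_fun setT (cabs \o \val f).
Proof. by have [? ?] := L2fun_measurable f; exact: measurable_cabs. Qed.

Definition L2fun_norm (f : L2fun_type) : \bar R :=
  'N[mu]_2[EFin \o (cabs \o \val f)]%E.

Lemma L2fun_norm_fin f : L2fun_norm f \is a fin_num.
Proof.
rewrite fin_numElt (lt_le_trans ltNy0) ?Lnorm_ge0//=.
have [m1 m2] := L2fun_measurable f.
have mN (h : T -> R) : measurable_fun setT h ->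
    measurable_fun setT (fun x => `|h x|).
  by move=> mh; exact: measurableT_comp.
have NN (h : T -> R) : 'N[mu]_2[EFin \o (fun x => `|h x|)%R]%E = 'N[mu]_2[EFin \o h]%E.
  by rewrite -[RHS]Lnorm_abse.
apply: (@le_lt_trans _ _ ('N[mu]_2[EFin \o
  ((fun x => `|(@complex.Re R \o \val f) x|) \+
   (fun x => `|(@complex.Im R \o \val f) x|))%R])%E).
  apply: le_Lnorm2.
  - exact: measurable_cabs_L2.
  - by apply: measurable_funD; exact: mN.
  - by move=> x; rewrite cabs_ge0 /= cabs_le.
apply: (le_lt_trans (eminkowski _ _ _ _)); [exact: mN|exact: mN|exact: lee1n|].
rewrite !NN.
case: f {m1 m2} => f /=; rewrite inE => -[/andP[_ +] /andP[_ +]].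
by rewrite !inE => ? ?; exact: lte_add_pinfty.
Qed.

Lemma L2fun_norm_ae f g : \val f = \val g %[ae mu] -> L2fun_norm f = L2fun_norm g.
Proof.
move=> fg; rewrite /L2fun_norm unlock; congr poweR.
apply: ae_eq_integral => //.
- by apply: mp; exact: measurable_cabs_L2.
- by apply: mp; exact: measurable_cabs_L2.
by apply: filterS fg => x /= + _ => ->.
Qed.

Definition L2norm (u : L2) : C := (fine (L2fun_norm (repr u)))%:C%C.

Lemma L2norm_pi f : L2norm (\pi_L2 f) = (fine (L2fun_norm f))%:C%C.
Proof. by rewrite /L2norm (@L2fun_norm_ae _ f)//; exact: repr_pi_ae. Qed.

Let L2normD u v : L2norm (u + v) <= L2norm u + L2norm v.
Proof.
rewrite -[u]reprK -[v]reprK -L2piD !L2norm_pi -rmorphD/= lecR.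
move: (repr u) (repr v) => f g.
rewrite -fineD ?L2fun_norm_fin// fine_le ?fin_numD ?L2fun_norm_fin//.
apply: (@le_trans _ _ 'N[mu]_2[EFin \o ((cabs \o \val f) \+ (cabs \o \val g))%R]%E).
  apply: le_Lnorm2.
  - exact: measurable_cabs_L2.
  - by apply: measurable_funD; exact: measurable_cabs_L2.
  - by move=> x; rewrite cabs_ge0/= cabsD.
by apply: eminkowski; [exact: measurable_cabs_L2|exact: measurable_cabs_L2|exact: lee1n].
Qed.

Let L2normZ (a : C) (u : L2) : L2norm (a *: u) = `|a| * L2norm u.
Proof.
rewrite -[u]reprK; move: (repr u) => f.
rewrite [a *: _]L2scale_pi !L2norm_pi -cabsC -rmorphM/=; congr (_%:C)%C.
have Lf : cabs \o \val f \in Lfun mu 2.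
  rewrite inE; apply/andP; split; rewrite inE/=; first exact: measurable_cabs_L2.
  by move: (L2fun_norm_fin f); rewrite fin_numElt => /andP[].
have := LnormZ (Lfun_Sub (lee1n 2) Lf) (cabs a).
rewrite ger0_norm ?cabs_ge0// => H.
rewrite /L2fun_norm (_ : EFin \o (cabs \o \val (a *: f)) =
  EFin \o (cabs a \*: (cabs \o \val f))); last first.
  by apply/funext => x /=; rewrite fctE cabsM.
by rewrite H fineM// L2fun_norm_fin.
Qed.

Let L2norm_eq0 u : L2norm u = 0 -> u = 0.
Proof.
rewrite -[u]reprK; move: (repr u) => f.
rewrite L2norm_pi => /complexI/eqP; rewrite fine_eq0 ?L2fun_norm_fin//.
move=> /eqP /Lnorm_eq0_eq0 f0.
have {}f0 : EFin \o (cabs \o \val f) = \0 %[ae mu].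
  by apply: f0; rewrite ?lte0n//; apply/measurable_EFinP; exact: measurable_cabs_L2.
have <- : \pi_L2 0 = 0 by exact: raddf0.
apply/L2_eqP; apply: filterS f0 => x /= f0 _.
by have /(_ I)[] := f0 => /cabs_eq0.
Qed.

HB.instance Definition _ := @Lmodule_isNormed.Build C L2 L2norm
  L2normD L2normZ L2norm_eq0.

(* [L2class g] is the class of g when g is square integrable, and 0 otherwise. *)
Definition L2class (g : T -> C) : L2 :=
  if insub g is Some f then \pi_L2 f else 0.

Lemma L2classE (f : L2fun_type) : L2class (\val f) = \pi_L2 f.
Proof. by rewrite /L2class valK. Qed.

(* M_phi; meaningful for phi essentially bounded, see [mulop_pi]. *)
Definition mulop (phi : T -> C) (u : L2) : L2 :=
  L2class (fun x => phi x * \val (repr u) x).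

Lemma Lfunoo_bounded (g : T -> R) : g \in Lfun mu +oo%E ->
  exists2 M : R, 0 <= M & \forall x \ae mu, `|g x| <= M.
Proof.
rewrite inE => /andP[_]; rewrite inE/= /finite_norm unlock.
case: ifPn => [mu0 H|].
  have H0 : (0 <= ess_sup mu (abse \o (EFin \o g)))%E.
    by apply: ess_sup_gee => //; apply: nearW => x; exact: abse_ge0.
  exists (fine (ess_sup mu (abse \o (EFin \o g)))); first exact: fine_ge0.
  have := ess_sup_ge mu (abse \o (EFin \o g)).
  apply: filterS => x /=; rewrite -lee_fin fineK// ge0_fin_numE//.
rewrite -leNgt measure_le0 => /eqP mu0 _; exists 0 => //.
exact: measure0_ae.
Qed.

Lemma Lfunoo_mul2 (g f : T -> R) : g \in Lfun mu +oo%E -> f \in Lfun mu 2 ->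
  (g \* f) \in Lfun mu 2.
Proof.
move=> /[dup] goo /Lfunoo_bounded[M M0 gM] f2.
have [_ ZD] := Lfun_submod_closed mu (@lee1n R 2).
have [Z0 _] := Lfun_submod_closed mu (@lee1n R 2).
have Mf : M *: f + 0 \in Lfun mu 2 by exact: ZD.
have mg : measurable_fun setT g.
  by move: goo; rewrite inE => /andP[+ _]; rewrite inE.
have mf : measurable_fun setT f.
  by move: f2; rewrite inE => /andP[+ _]; rewrite inE.
have mgf : measurable_fun setT (g \* f) by exact: measurable_funM.
rewrite inE; apply/andP; split; rewrite inE//=.
move: Mf; rewrite inE => /andP[+ Mf]; rewrite inE/= => mMf.
move: Mf; rewrite inE/=; apply: le_lt_trans.
rewrite unlock; apply: gt0_ler_poweR.
- by rewrite invr_ge0.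
- by rewrite in_itv/= leey andbT integral_ge0// => x _; exact: poweR_ge0.
- by rewrite in_itv/= leey andbT integral_ge0// => x _; exact: poweR_ge0.
apply: ae_ge0_le_integral => //=; try exact: mp; try by move=> x _; exact: poweR_ge0.
apply: filterS gM => x gM _.
rewrite lee_fin ge0_ler_powR ?nnegrE// !fctE addr0.
by rewrite normrM [leRHS]normrM ler_wpM2r// (ger0_norm M0).
Qed.

Lemma mulop_L2fun (phi f : T -> C) :
  cLfun +oo%E phi -> f \in L2fun -> (fun x => phi x * f x) \in L2fun.
Proof.
move=> [p1 p2]; rewrite !inE => -[f1 f2].
have [_ ZD] := Lfun_submod_closed mu (@lee1n R 2).
split.
  rewrite (_ : _ \o _ = (-1) *: ((@complex.Im R \o phi) \* (@complex.Im R \o f)) +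
    ((@complex.Re R \o phi) \* (@complex.Re R \o f))).
    by apply: (ZD); exact: Lfunoo_mul2.
  apply/funext => x.
  change (complex.Re (phi x * f x) = -1 * (complex.Im (phi x) * complex.Im (f x)) + complex.Re (phi x) * complex.Re (f x)).
  by case: (phi x) (f x) => [a b] [c e] /=; ring.
rewrite (_ : _ \o _ = 1 *: ((@complex.Im R \o phi) \* (@complex.Re R \o f)) +
    ((@complex.Re R \o phi) \* (@complex.Im R \o f))).
  by apply: (ZD); exact: Lfunoo_mul2.
apply/funext => x.
change (complex.Im (phi x * f x) = 1 * (complex.Im (phi x) * complex.Re (f x)) + complex.Re (phi x) * complex.Im (f x)).
by case: (phi x) (f x) => [a b] [c e] /=; ring.
Qed.

Lemma mulop_pi (phi : T -> C) (f g : L2fun_type) : cLfun +oo%E phi ->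
  (forall x, \val g x = phi x * \val f x) -> mulop phi (\pi_L2 f) = \pi_L2 g.
Proof.
move=> phioo fg; rewrite /mulop.
have H := mulop_L2fun phioo (valP (repr (\pi_L2 f))).
rewrite -[X in L2class X](SubK L2fun_type H) L2classE; apply/L2_eqP.
apply: filterS (repr_pi_ae f) => x /= E _.
by rewrite fg E.
Qed.

Definition cintegral (f : T -> C) : C :=
  Complex (\int[mu]_x complex.Re (f x))%R
    (\int[mu]_x complex.Im (f x))%R.

Definition L2inner (u v : L2) : C :=
  cintegral (fun x => \val (repr u) x * (\val (repr v) x)^*).

End L2_functions.

(* The Borel sigma-algebra of X. Sigma-finiteness of standard measures is carried
   by the type {sigma_finite_measure set _ -> \bar _}. *)
Notation borel X := (g_sigma_algebraType (@open X)).

Definition separable (X : topologicalType) :=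
  exists2 D : set X, countable D & dense D.

Section standard_measure.
Context (R : realType) (X : completeMetricType R).

Definition regular_measure (mu : set (borel X) -> \bar R) :=
  forall A : set (borel X), measurable A ->
    mu A = ereal_sup [set mu K | K in [set K : set X | compact K /\ K `<=` A]] /\
    mu A = ereal_inf [set mu U | U in [set U : set X | open U /\ A `<=` U]].

Definition standard_measure (mu : set (borel X) -> \bar R) :=
  separable X /\ regular_measure mu.

End standard_measure.

Section operators.
Context (R : realType) (V W : normedModType R[i]).
Implicit Types (T : V -> W) (U : set (V -> W)).

Definition bounded_op : set (V -> W) :=
  [set T | linear T /\ exists M : R[i], forall u, `|T u| <= M * `|u|].

Definition compact_op T := bounded_op T /\
  compact (closure (T @` [set u | `|u| <= 1])).

Definition finite_rank_op T := bounded_op T /\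
  exists n (w : 'I_n -> W), forall u, exists c : 'I_n -> R[i],
    T u = \sum_(i < n) c i *: w i.

Definition rank_one_op T := bounded_op T /\
  exists2 w : W, w != 0 & range T = [set c *: w | c in [set: R[i]]].

Definition lin_span (A : set W) : set W :=
  [set x | exists n (c : 'I_n -> R[i]) (w : 'I_n -> W),
    (forall i, A (w i)) /\ x = \sum_(i < n) c i *: w i].

Definition Ref U : set (V -> W) :=
  [set T | bounded_op T /\
    forall xi, closure (lin_span [set S xi | S in U]) (T xi)].

Definition square_summable (xi : V^nat) :=
  cvgn (series (fun k => `|xi k| ^+ 2)).
End operators.

Section bimodules.
Context d1 d2 (X : measurableType d1) (Y : measurableType d2) (R : realType).
Variables (mu : {measure set X -> \bar R}) (nu : {measure set Y -> \bar R}).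
Implicit Types (T : L2 mu -> L2 nu) (U V : set (L2 mu -> L2 nu)).
Implicit Types (sigma tau : set (X * Y)).

Definition marginally_null sigma :=
  exists M1 M2, [/\ measurable M1, mu M1 = 0, measurable M2, nu M2 = 0 &
    sigma `<=` (M1 `*` [set: Y]) `|` ([set: X] `*` M2)].

Definition marginally_equiv sigma tau :=
  marginally_null ((sigma `\` tau) `|` (tau `\` sigma)).

Definition cindic d (Z : measurableType d) (A : set Z) : Z -> R[i] :=
  fun z => (\1_A z)%:C%C.

Definition supported_on sigma T :=
  forall alpha beta, measurable alpha -> measurable beta ->
    marginally_equiv ((alpha `*` beta) `&` sigma) set0 ->
    mulop (cindic beta) \o T \o mulop (cindic alpha) = 0.

Definition Mmax sigma : set (L2 mu -> L2 nu) :=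
  [set T | bounded_op T /\ supported_on sigma T].

Definition bimodule U :=
  [/\ U `<=` @bounded_op R (L2 mu) (L2 nu),
      U 0,
      forall a S T, U S -> U T -> U (a *: S + T) &
      forall phi psi T, cLfun mu +oo%E phi -> cLfun nu +oo%E psi -> U T ->
        U (mulop psi \o T \o mulop phi)].

(* B(H1, H2) is the dual of the trace class operators: its weak* topology is the
   coarsest one making T |-> \sum_k <T xi_k, eta_k> continuous for all square
   summable sequences xi in H1 and eta in H2, i.e. the initial topology for the
   map sending T to the family of these values. *)
Definition weakstar_index :=
  {p : (L2 mu)^nat * (L2 nu)^nat | square_summable p.1 /\ square_summable p.2}.

Definition weakstar_pairing T : {ptws weakstar_index -> R[i]} :=
  fun p => limn (series (fun k => L2inner (T ((sval p).1 k)) ((sval p).2 k))).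

Definition weakstar_closed U :=
  U `<=` @bounded_op R (L2 mu) (L2 nu) /\
  closure (U : set (initial_topology weakstar_pairing)) `&`
    @bounded_op R (L2 mu) (L2 nu) `<=` U.

Definition Ref_family U : set (set (L2 mu -> L2 nu)) :=
  [set V | [/\ weakstar_closed V, bimodule V, V `<=` U & Ref V = Ref U]].

(* The smallest element of [Ref_family U], see [bimodule_min_smallest]. *)
Definition bimodule_min U : set (L2 mu -> L2 nu) :=
  \bigcap_(V in Ref_family U) V.

Lemma bimodule_min_smallest U V : Ref_family U V ->
  (forall W, Ref_family U W -> V `<=` W) -> bimodule_min U = V.
Proof.
move=> UV minV; apply/seteqP; split=> [T /(_ V UV)//|T VT W UW].
exact: minV VT.
Qed.

Definition Mmin sigma := bimodule_min (Mmax sigma).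

End bimodules.

Arguments marginally_null {d1 d2 X Y R} mu nu sigma.
Arguments marginally_equiv {d1 d2 X Y R} mu nu sigma tau.
Arguments Mmax {d1 d2 X Y R} mu nu sigma _.
Arguments Mmin {d1 d2 X Y R} mu nu sigma _.

(* Main.v *)
Require Import Defs.
From HB Require Import structures.
From mathcomp Require Import all_boot all_order all_algebra.
From mathcomp Require Import complex ring lra.
From mathcomp Require Import all_classical all_reals all_analysis.
From mathcomp Require Import measurable_realfun ess_sup_inf.

Set Implicit Arguments.
Unset Strict Implicit.
Unset Printing Implicit Defensive.
Import Order.TTheory GRing.Theory Num.Theory.
Import numFieldNormedType.Exports.
Local Open Scope classical_set_scope.
Local Open Scope ring_scope.

(** Call a bounded operator A : L2(mu1) -> L2(mu) an intertwiner of theta when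
    A chi_beta = chi_(theta^-1 beta) A for all measurable beta. For every xi in L2(mu) there
    are an intertwiner A and a vector f with A f = xi and A^* xi = f: take
    A u = xi (u / sqrt h) o theta and f = sqrt h, where h is the density of
    theta_*(|xi|^2 mu) with respect to mu1. If A and B are intertwiners of theta and rho,
    then T |-> B^* T A maps Mmax(E) to Mmax(E1), and some A, B give B^* T A <> 0 when T <> 0;
    this settles the statement on Mmax.

    For Mmin, let V1 be a weak* closed bimodule with Ref V1 = Ref(Mmax(E1)) and let V be the
    weak* closed bimodule of all T in Mmax(E) with B^* T A in V1 for all intertwiners A, B.
    For S1 in V1 the operator B S1 A^* lies in V: it lies in Mmax(E) because a measurable set
    is, up to a null set, a countable union of compact sets with compact images under theta
    (Lusin), and B'^* B S1 A^* A' is in V1 because B'^* B and A^* A' commute with the masas,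
    hence are multiplication operators. If q is orthogonal to V xi, choose A f = xi and
    B g = q as above; then V1 f is orthogonal to g, hence so is B^* T A f for T in Mmax(E),
    that is, T xi is orthogonal to q. So Ref V = Ref(Mmax(E)), Mmin(E) is contained in V, and
    T |-> B^* T A maps Mmin(E) to Mmin(E1). *)

(** * The inner product of L2 *)

Section cabs_sqr.
Context (R : realType).
Implicit Types z w : R[i].

Lemma cabs_sqr z : cabs z ^+ 2 = complex.Re z ^+ 2 + complex.Im z ^+ 2.
Proof. by rewrite cabsE sqr_sqrtr// addr_ge0// sqr_ge0. Qed.

Lemma mul_conj_cabs z : z * z^* = (cabs z ^+ 2)%:C%C.
Proof.
rewrite cabs_sqr; case: z => a b; apply/eqP; rewrite eq_complex /=.
by apply/andP; split; apply/eqP; ring.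
Qed.

Lemma Re_mul_conj z w :
  complex.Re (z * w^*) = complex.Re z * complex.Re w + complex.Im z * complex.Im w.
Proof. by case: z w => [a b] [c d] /=; ring. Qed.

Lemma Im_mul_conj z w :
  complex.Im (z * w^*) = complex.Im z * complex.Re w - complex.Re z * complex.Im w.
Proof. by case: z w => [a b] [c d] /=; ring. Qed.

End cabs_sqr.

Notation "''[' u , v ]" := (L2inner u v) : ring_scope.

Section inner.
Context d (T : measurableType d) (R : realType) (mu : {measure set T -> \bar R}).
Local Notation C := R[i].
Local Notation L2fun_type := (L2fun_type mu).
Local Notation pi := (\pi_(L2 mu)%qT : L2fun_type -> L2 mu).

Definition cintegrable (f : T -> C) :=
  mu.-integrable setT (EFin \o (@complex.Re R \o f)) /\
  mu.-integrable setT (EFin \o (@complex.Im R \o f)).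

Lemma cintegralD f g : cintegrable f -> cintegrable g ->
  cintegral mu (fun x => f x + g x) = cintegral mu f + cintegral mu g.
Proof.
move=> [f1 f2] [g1 g2]; rewrite /cintegral.
apply/eqP; rewrite eq_complex /= -!RintegralD//.
apply/andP; split; apply/eqP; congr Rintegral;
  by apply/funext => x; case: (f x) (g x) => [? ?] [? ?].
Qed.

Lemma cintegralZ a f : cintegrable f ->
  cintegral mu (fun x => a * f x) = a * cintegral mu f.
Proof.
move=> [f1 f2]; have Z r (h : T -> R) : mu.-integrable setT (EFin \o h) ->
    mu.-integrable setT (EFin \o (fun x => r * h x)).
  by move=> ih; exact: (integrableZl measurableT r ih).
rewrite /cintegral; case: a => a b; apply/eqP; rewrite eq_complex /= -!RintegralZl//.
rewrite -RintegralB//; [|exact: Z|exact: Z].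
rewrite -RintegralD//; [|exact: Z|exact: Z].
apply/andP; split; apply/eqP; congr Rintegral;
  by apply/funext => x; case: (f x) => ? ? /=.
Qed.

Lemma cintegral_conj f : cintegrable f ->
  cintegral mu (fun x => (f x)^*) = (cintegral mu f)^*.
Proof.
move=> [f1 f2]; apply/eqP; rewrite eq_complex /=; apply/andP; split; apply/eqP.
  by congr Rintegral; apply/funext => x; case: (f x).
rewrite -mulN1r -RintegralZl//; congr Rintegral.
by apply/funext => x; case: (f x) => a b; rewrite mulN1r.
Qed.

Lemma L2fun_cLfun (f : L2fun_type) : cLfun mu 2%:E (\val f).
Proof. by have := valP f; rewrite inE. Qed.

Lemma cintegrable_mul_conj (f g : L2fun_type) :
  cintegrable (fun x => \val f x * (\val g x)^*).
Proof.
have [f1 f2] := L2fun_cLfun f; have [g1 g2] := L2fun_cLfun g.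
have H := fun a b ha hb => (Lfun1_integrable mu _).1 (@Lfun2_mul_Lfun1 _ _ _ mu a b ha hb).
split.
- rewrite (_ : _ \o _ = (EFin \o (((@complex.Re R \o \val f) \* (@complex.Re R \o \val g))%R)) \+
    (EFin \o (((@complex.Im R \o \val f) \* (@complex.Im R \o \val g))%R)))%E.
    by apply: integrableD => //; exact: H.
  by apply/funext => x /=; rewrite Re_mul_conj.
- rewrite (_ : _ \o _ = (EFin \o (((@complex.Im R \o \val f) \* (@complex.Re R \o \val g))%R)) \-
    (EFin \o (((@complex.Re R \o \val f) \* (@complex.Im R \o \val g))%R)))%E.
    by apply: integrableB => //; exact: H.
  by apply/funext => x /=; rewrite Im_mul_conj.
Qed.

Lemma eq_ae_cintegral (f g : T -> C) : cintegrable f -> cintegrable g ->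
  f = g %[ae mu] -> cintegral mu f = cintegral mu g.
Proof.
move=> [f1 f2] [g1 g2] fg; congr Complex; congr fine; apply: ae_eq_integral => //;
  [exact: measurable_int f1|exact: measurable_int g1| |
   exact: measurable_int f2|exact: measurable_int g2|];
  by apply: filterS fg => x /= + _ => ->.
Qed.

Lemma L2inner_pi (f g : L2fun_type) :
  L2inner (pi f) (pi g) = cintegral mu (fun x => \val f x * (\val g x)^*).
Proof.
apply: eq_ae_cintegral; [exact: cintegrable_mul_conj..|].
by apply: filterS2 (repr_pi_ae f) (repr_pi_ae g) => x /= + + _ => -> // ->.
Qed.

(** The norm of [L2 mu] has values in R[i]; its real part allows estimates to be carried out in the
    ordered field R. *)
Definition hnorm (u : L2 mu) : R := complex.Re `|u|.

Lemma hnormE u : `|u| = (hnorm u)%:C%C.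
Proof. by []. Qed.

Lemma hnorm_ge0 u : 0 <= hnorm u.
Proof. by rewrite -lecR -hnormE; exact: normr_ge0. Qed.

Lemma hnorm_sqr_pi (f : L2fun_type) :
  ((hnorm (pi f)) ^+ 2)%:E = (\int[mu]_x ((cabs (\val f x)) ^+ 2)%:E)%E.
Proof.
change ((complex.Re (L2norm (pi f)) ^+ 2)%:E = (\int[mu]_x ((cabs (\val f x)) ^+ 2)%:E)%E).
rewrite L2norm_pi /=.
have := @poweR_Lnorm _ _ _ mu (EFin \o (@cabs R \o \val f)) 2.
rewrite pnatr_eq0 => /(_ isT); rewrite -/(L2fun_norm f).
rewrite -[X in (X `^ 2)%E](fineK (L2fun_norm_fin f)) poweR_EFin powR_mulrn; last first.
  by rewrite fine_ge0// Lnorm_ge0.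
move=> ->; apply: eq_integral => x _.
by rewrite /comp abse_EFin poweR_EFin powR_mulrn// real_normK// num_real.
Qed.

Lemma innerDl (u v w : L2 mu) : '[u + v, w] = '[u, w] + '[v, w].
Proof.
rewrite -[u]reprK -[v]reprK -[w]reprK -L2piD !L2inner_pi.
rewrite -cintegralD; [|exact: cintegrable_mul_conj..].
by congr cintegral; apply/funext => x; rewrite /= fctE mulrDl.
Qed.

Lemma innerZl a (u w : L2 mu) : '[a *: u, w] = a * '[u, w].
Proof.
rewrite -[u]reprK -[w]reprK [a *: _]L2scale_pi !L2inner_pi.
rewrite -cintegralZ; last exact: cintegrable_mul_conj.
by congr cintegral; apply/funext => x; rewrite mulrA.
Qed.

Lemma innerC (u v : L2 mu) : '[v, u] = '[u, v]^*.
Proof.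
rewrite -[u]reprK -[v]reprK !L2inner_pi.
rewrite -cintegral_conj; last exact: cintegrable_mul_conj.
by congr cintegral; apply/funext => x; rewrite rmorphM/= conjCK mulrC.
Qed.

Lemma innerxx (u : L2 mu) : '[u, u] = `|u| ^+ 2.
Proof.
rewrite hnormE -rmorphXn /= -[u]reprK L2inner_pi.
transitivity (Complex (\int[mu]_x (cabs (\val (repr u) x) ^+ 2))%R (\int[mu]_x 0)%R).
  by congr Complex; congr Rintegral; apply/funext => x; rewrite mul_conj_cabs.
rewrite (@Rintegral_cst _ _ _ mu)// mul0r.
by rewrite /Rintegral -hnorm_sqr_pi.
Qed.

Lemma innerDr (u v w : L2 mu) : '[w, u + v] = '[w, u] + '[w, v].
Proof. by rewrite innerC innerDl rmorphD/= -!innerC. Qed.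

Lemma innerZr a (u w : L2 mu) : '[w, a *: u] = a^* * '[w, u].
Proof. by rewrite innerC innerZl rmorphM/= -innerC. Qed.

Lemma inner0l (w : L2 mu) : '[0, w] = 0.
Proof. by rewrite -[0 in LHS](scale0r 0) innerZl mul0r. Qed.

Lemma inner0r (w : L2 mu) : '[w, 0] = 0.
Proof. by rewrite innerC inner0l rmorph0. Qed.

Lemma innerBl (u v w : L2 mu) : '[u - v, w] = '[u, w] - '[v, w].
Proof. by rewrite innerDl -scaleN1r innerZl mulN1r. Qed.

Lemma innerBr (u v w : L2 mu) : '[w, u - v] = '[w, u] - '[w, v].
Proof. by rewrite innerC innerBl rmorphB/= -!innerC. Qed.

Lemma inner_eq0 (u : L2 mu) : '[u, u] = 0 -> u = 0.
Proof. by rewrite innerxx => /eqP; rewrite sqrf_eq0 normr_eq0 => /eqP. Qed.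

Lemma inner_ext (u v : L2 mu) : (forall w, '[w, u] = '[w, v]) -> u = v.
Proof.
by move=> uv; apply/eqP; rewrite -subr_eq0; apply/eqP/inner_eq0; rewrite innerBr uv subrr.
Qed.

(* For e = 0 this is Cauchy-Schwarz. When |x|^2 - e bounds from below the squared distances
   from x to a subspace containing k, it yields both the Cauchy property of a minimizing
   sequence and the orthogonality of its limit. *)
Lemma near_minimizer_inner (e : C) (x k : L2 mu) :
  (forall t, `|x| ^+ 2 - e <= `|x - t *: k| ^+ 2) ->
  `|'[x, k]| ^+ 2 <= e * `|k| ^+ 2.
Proof.
have [->|k0] := eqVneq k 0; first by rewrite inner0r !normr0 expr0n/= mulr0.
have k2 : 0 < `|k| ^+ 2 by rewrite exprn_gt0// normr_gt0.
(* This t minimizes |x - t k|; the minimum of the square is |x|^2 - |<x, k>|^2 / |k|^2. *)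
move=> /(_ ('[x, k] / `|k| ^+ 2)).
rewrite -[X in _ <= X -> _]innerxx innerBl !innerBr !innerZl !innerZr.
rewrite (innerC x k) !innerxx rmorphM fmorphV /= (_ : (`|k| ^+ 2)^* = `|k| ^+ 2); last first.
  by apply/CrealP; rewrite rpredX// normr_real.
move: k2; set K := `|k| ^+ 2; set z := '[x, k] => k2.
rewrite -!mulrA mulVf ?gt_eqF// mulr1 subrr subr0 lerD2l lerN2.
by rewrite mulrCA (mulrC z^*) -normCK mulrC ler_pdivrMr.
Qed.

Lemma inner_le (u v : L2 mu) : `|'[u, v]| <= `|u| * `|v|.
Proof.
rewrite -(@ler_pXn2r _ 2)// ?nnegrE// ?mulr_ge0// exprMn.
by apply: near_minimizer_inner => t; rewrite subrr exprn_ge0.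
Qed.

End inner.

(** * Completeness of L2 *)

Section completeness.
Context d (T : measurableType d) (R : realType) (mu : {measure set T -> \bar R}).
Local Notation C := R[i].
Local Notation L2fun_type := (L2fun_type mu).
Local Notation pi := (\pi_(L2 mu)%qT : L2fun_type -> L2 mu).

Definition cmeasurable (f : T -> C) :=
  measurable_fun setT (@complex.Re R \o f) /\ measurable_fun setT (@complex.Im R \o f).

Lemma measurable_cabs_sqr (f : T -> C) : cmeasurable f ->
  measurable_fun setT (fun x => (cabs (f x) ^+ 2)%:E).
Proof.
move=> [mf1 mf2]; apply/measurable_EFinP/measurable_funX.
exact: (measurable_cabs mf1 mf2).
Qed.

(** Replaces the conditions on real and imaginary parts by a single one on |f|^2, the form in which
    norms are computed below. *)
Lemma L2funP (f : T -> C) :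
  f \in L2fun mu <-> cmeasurable f /\ (\int[mu]_x (cabs (f x) ^+ 2)%:E < +oo)%E.
Proof.
split=> [f2|[[mr mi] foo]].
  have [? ?] := L2fun_measurable (exist _ f f2 : L2fun_type); split=> //.
  by rewrite -(hnorm_sqr_pi (exist _ f f2 : L2fun_type)) ltry.
have H (g : T -> R) : measurable_fun setT g ->
    (forall x, g x ^+ 2 <= cabs (f x) ^+ 2) -> g \in Lfun mu 2.
  move=> mg gf; rewrite inE; apply/andP; split; rewrite inE//=.
  rewrite /finite_norm unlock poweR_lty//; apply: le_lt_trans foo.
  apply: ge0_le_integral => //=.
  - apply: (eq_measurable_fun (fun x => (g x ^+ 2)%:E)).
      by move=> x _; rewrite powR_mulrn// real_normK// num_real.
    by apply/measurable_EFinP; exact: measurable_funX.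
  - exact: measurable_cabs_sqr.
  by move=> x _; rewrite powR_mulrn// real_normK ?num_real// lee_fin.
rewrite inE; split; apply: H => // x; rewrite cabs_sqr /=.
  by rewrite lerDl sqr_ge0.
by rewrite lerDr sqr_ge0.
Qed.

Lemma hnorm_Lnorm (f : L2fun_type) :
  (hnorm (pi f))%:E = 'N[mu]_2[EFin \o (@cabs R \o \val f)]%E.
Proof.
rewrite /hnorm; change ((complex.Re (L2norm (pi f)))%:E = L2fun_norm f).
by rewrite L2norm_pi /= fineK// L2fun_norm_fin.
Qed.

Lemma hnormD (u v : L2 mu) : hnorm (u + v) <= hnorm u + hnorm v.
Proof. by rewrite -lecR rmorphD/= -!hnormE ler_normD. Qed.

Lemma hnorm0 : hnorm (0 : L2 mu) = 0.
Proof. by rewrite /hnorm normr0. Qed.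

Lemma fast_cauchy_dist (u : (L2 mu)^nat) :
  (forall n, hnorm (u n.+1 - u n) <= 2^-1 ^+ n) ->
  forall n m, hnorm (u (m + n)%N - u n) <= 2 * 2^-1 ^+ n.
Proof.
move=> u2 n m; apply: (@le_trans _ _ ((2 - 2 * 2^-1 ^+ m) * 2^-1 ^+ n)); last first.
  by rewrite ler_wpM2r ?exprn_ge0// gerBl mulr_ge0 ?exprn_ge0.
elim: m => [|m IH]; first by rewrite add0n subrr hnorm0 expr0 mulr1 subrr mul0r.
rewrite addSn -(subrKA (u (m + n)%N)).
apply: (le_trans (hnormD _ _)); apply: (le_trans (lerD (u2 _) IH)).
rewrite exprD -mulrDl ler_wpM2r ?exprn_ge0//.
rewrite exprS; lra.
Qed.

(** Riesz-Fischer for geometrically Cauchy sequences: the increments are absolutely summable almost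
    everywhere because their partial sums [S] are bounded in L2, and Fatou's lemma turns the
    pointwise limit into a limit in norm with an explicit rate. *)
Lemma L2_fast_cauchy (u : (L2 mu)^nat) :
  (forall n, hnorm (u n.+1 - u n) <= 2^-1 ^+ n) ->
  exists v, forall n, hnorm (v - u n) <= 2 * 2^-1 ^+ n.
Proof.
move=> u2.
pose f n := \val (repr (u n)).
have mf n : cmeasurable (f n) by exact: L2fun_measurable.
have subE m n : u m - u n = pi (repr (u m) - repr (u n)).
  by rewrite raddfB/= !reprK.
pose g n x := cabs (f n.+1 x - f n x).
have mg n : measurable_fun setT (g n).
  exact: (measurable_cabs_L2 (repr (u n.+1) - repr (u n))).
have g0 n x : 0 <= g n x by exact: cabs_ge0.
pose S n x := \sum_(k < n) g k x.
have mS n : measurable_fun setT (S n) by exact: measurable_sum.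
have S0 n x : 0 <= S n x by rewrite sumr_ge0.
have NS n : ('N[mu]_2[EFin \o S n] <= (2 - 2 * 2^-1 ^+ n)%:E)%E.
  elim: n => [|n IH].
    rewrite (_ : _ \o _ = cst 0%E) ?Lnorm0 ?expr0 ?mulr1 ?subrr//.
    by apply/funext => x; rewrite /S /= big_ord0.
  rewrite (_ : S n.+1 = S n \+ g n)%R; last first.
    by apply/funext => x; rewrite /S big_ord_recr.
  apply: (@le_trans _ _ (_ + _)%E); first by apply: eminkowski => //; exact: lee1n.
  apply: (@le_trans _ _ ((2 - 2 * 2^-1 ^+ n)%:E + (2^-1 ^+ n)%:E)%E).
    apply: leeD => //; rewrite -(hnorm_Lnorm (repr (u n.+1) - repr (u n))).
    by rewrite lee_fin -subE.
  rewrite -EFinD lee_fin exprS; lra.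
have intS n : (\int[mu]_x ((S n x) ^+ 2)%:E <= 4%:E)%E.
  have := @poweR_Lnorm _ _ _ mu (EFin \o S n) 2.
  rewrite pnatr_eq0 => /(_ isT) H.
  have -> : (\int[mu]_x ((S n x) ^+ 2)%:E = 'N[mu]_2[EFin \o S n] `^ 2)%E.
    rewrite H; apply: eq_integral => x _.
    by rewrite /comp abse_EFin poweR_EFin powR_mulrn// real_normK// num_real.
  apply: (@le_trans _ _ (2%:E `^ 2)%E).
    apply: gt0_ler_poweR => //; rewrite ?in_itv/= ?leey ?andbT ?Lnorm_ge0 ?lee_fin//.
    by apply: (le_trans (NS n)); rewrite lee_fin gerBl mulr_ge0 ?exprn_ge0.
  by rewrite poweR_EFin powR_mulrn// lee_fin; lra.
(* By monotone convergence the integral of G is at most 4, so G is finite almost everywhere. *)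
pose G x := limn (fun n => ((S n x) ^+ 2)%:E).
have ndS x : nondecreasing_seq (fun n => (S n x) ^+ 2).
  apply/nondecreasing_seqP => n; rewrite ler_sqr ?nnegrE//.
  by rewrite /S big_ord_recr /= lerDl.
have ndSE x : nondecreasing_seq (fun n => ((S n x) ^+ 2)%:E).
  by move=> m n mn; rewrite lee_fin ndS.
have cvgG x : (fun n => ((S n x) ^+ 2)%:E) @ \oo --> G x.
  exact: (@ereal_nondecreasing_is_cvgn R _ (ndSE x)).
have mSE n : measurable_fun setT (fun x => ((S n x) ^+ 2)%:E).
  by apply/measurable_EFinP; exact: measurable_funX.
have mG : measurable_fun setT G by apply: (@emeasurable_fun_cvg _ _ _ setT _ G mSE) => x _; exact: cvgG.
have SG n x : (((S n x) ^+ 2)%:E <= G x)%E.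
  rewrite /G (cvg_lim _ (ereal_nondecreasing_cvgn (ndSE x)))//.
  by apply: ereal_sup_ubound; exists n.
have G0 x : (0 <= G x)%E by apply: le_trans (SG 0 x); rewrite lee_fin sqr_ge0.
have intG : mu.-integrable setT G.
  apply/integrableP; split=> //.
  under eq_integral do rewrite gee0_abs//.
  rewrite monotone_convergence//; last by move=> n x _; rewrite lee_fin sqr_ge0.
  apply: (@le_lt_trans _ _ 4%:E); last exact: ltry.
  apply: lime_le; last by apply: nearW => n; exact: intS.
  apply: ereal_nondecreasing_is_cvgn => m n mn; apply: ge0_le_integral => //.
  - by move=> x _; rewrite lee_fin sqr_ge0.
  by move=> x _; exact: ndSE.
pose P := [set x | G x \is a fin_num].
have mP : measurable P.
  by rewrite -[P]setTI; exact: emeasurable_fin_num.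
have aeP : \forall x \ae mu, P x.
  by apply: filterS (integrable_ae measurableT intG) => x; exact.
have cvgS (h : nat -> R) x : P x -> (forall n, `|h n.+1 - h n| <= g n x) -> cvgn h.
  move=> Px hg.
  suff : cvgn (series (fun n => h n.+1 - h n)).
    move=> hc; rewrite (_ : h = (fun n => h 0%N) \+ series (fun n => h n.+1 - h n)).
      by apply: is_cvgD => //; exact: is_cvg_cst.
    apply/funext => n; rewrite /= seriesEord /=.
    elim: n => [|n IH]; first by rewrite big_ord0 addr0.
    by rewrite big_ord_recr /= addrA -IH addrC subrK.
  apply: normed_cvg; apply: (@series_le_cvg _ _ (g ^~ x)) => //.
    by move=> n; exact: normr_ge0.
  apply: (@nondecreasing_is_cvgn R (series (g ^~ x))).
    by apply/nondecreasing_seqP => n; rewrite !seriesEord/= big_ord_recr/= lerDl.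
  (* S n x <= 1 + (S n x)^2 <= 1 + G x. *)
  exists (1 + fine (G x)) => _ [n _ <-]; rewrite seriesEord/=.
  have : S n x ^+ 2 <= fine (G x) by rewrite -lee_fin fineK.
  rewrite -/(S n x); have := S0 n x; nra.
(* Cutting off outside P makes the sequences converge at every point, so that the limit is
   measurable. *)
pose fr n x := complex.Re (f n x) * \1_P x.
pose fi n x := complex.Im (f n x) * \1_P x.
pose vr x := limn (fr ^~ x).
pose vi x := limn (fi ^~ x).
have cvgfr x : fr ^~ x @ \oo --> vr x.
  have [Px|Px] := pselect (P x); last first.
    rewrite /vr (_ : fr ^~ x = cst 0); first exact: is_cvg_cst.
    by apply/funext => n; rewrite /fr indicE memNset// mulr0.
  apply: (cvgS _ _ Px) => n; rewrite /fr indicE mem_set// !mulr1 /g cabsE.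
  rewrite -sqrtr_sqr ler_sqrt ?addr_ge0 ?sqr_ge0//.
  by case: (f n.+1 x) (f n x) => [a b] [c e] /=; rewrite lerDl sqr_ge0.
have cvgfi x : fi ^~ x @ \oo --> vi x.
  have [Px|Px] := pselect (P x); last first.
    rewrite /vi (_ : fi ^~ x = cst 0); first exact: is_cvg_cst.
    by apply/funext => n; rewrite /fi indicE memNset// mulr0.
  apply: (cvgS _ _ Px) => n; rewrite /fi indicE mem_set// !mulr1 /g cabsE.
  rewrite -sqrtr_sqr ler_sqrt ?addr_ge0 ?sqr_ge0//.
  by case: (f n.+1 x) (f n x) => [a b] [c e] /=; rewrite lerDr sqr_ge0.
pose v x := Complex (vr x) (vi x).
have mv : cmeasurable v.
  split.
    apply: (measurable_fun_cvg (h := fr)) => // n.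
    by apply: measurable_funM => //; exact: (mf n).1.
  apply: (measurable_fun_cvg (h := fi)) => // n.
  by apply: measurable_funM => //; exact: (mf n).2.
have mvf n : cmeasurable (fun x => v x - f n x).
  have [m1 m2] := mf n; have [m3 m4] := mv; split.
    rewrite (_ : _ \o _ = (@complex.Re R \o v) \- (@complex.Re R \o f n))%R.
      exact: measurable_funB.
    by apply/funext => x /=; case: (f n x).
  rewrite (_ : _ \o _ = (@complex.Im R \o v) \- (@complex.Im R \o f n))%R.
    exact: measurable_funB.
  by apply/funext => x /=; case: (f n x).
have dist n : (\int[mu]_x (cabs (v x - f n x) ^+ 2)%:E <= ((2 * 2^-1 ^+ n) ^+ 2)%:E)%E.
  pose w m x := (cabs (f (m + n)%N x - f n x) ^+ 2)%:E.
  have mw m : measurable_fun setT (w m).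
    apply: measurable_cabs_sqr.
    exact: (L2fun_measurable (repr (u (m + n)%N) - repr (u n))).
  have w0 m x : setT x -> (0 <= w m x)%E by move=> _; rewrite lee_fin sqr_ge0.
  have wint m : (\int[mu]_x w m x <= ((2 * 2^-1 ^+ n) ^+ 2)%:E)%E.
    rewrite -(hnorm_sqr_pi (repr (u (m + n)%N) - repr (u n))) -subE lee_fin.
    by rewrite ler_sqr ?nnegrE ?hnorm_ge0 ?mulr_ge0 ?exprn_ge0// fast_cauchy_dist.
  (* On P the integrand is the limit, hence the lower limit, of |f_(m+n) - f_n|^2 as m grows; this
     is the form that Fatou's lemma needs. *)
  rewrite (_ : (\int[mu]_x _ = \int[mu]_x limn_einf (w ^~ x))%E); last first.
    apply: ae_eq_integral => //.
    - exact: measurable_cabs_sqr.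
    - rewrite (_ : (fun x => limn_einf (w ^~ x)) = (fun x => - limn_esup ((fun k y => - w k y) ^~ x))%E).
        apply: measurableT_comp => //; apply: measurable_fun_limn_esup => k.
        exact: measurableT_comp.
      apply/funext => x; rewrite -limn_einfN/=; congr limn_einf; apply/funext => k.
      by change (w k x = - - w k x)%E; rewrite oppeK.
    apply: filterS aeP => x Px _.
    suff wc : w ^~ x @ \oo --> ((cabs (v x - f n x)) ^+ 2)%:E by have [-> _] := cvg_limn_einf_sup wc.
    apply: cvg_EFin; first exact: nearW.
    rewrite /w /=; under eq_fun do rewrite cabs_sqr; rewrite cabs_sqr.
    have [c1 c2] := (cvgfr x, cvgfi x).
    have frE m : complex.Re (f m x) = fr m x by rewrite /fr indicE mem_set// mulr1.
    have fiE m : complex.Im (f m x) = fi m x by rewrite /fi indicE mem_set// mulr1.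
    have E1 m : complex.Re (f (m + n)%N x - f n x) = fr (m + n)%N x - fr n x.
      by rewrite -!frE; case: (f (m + n)%N x) (f n x) => [? ?] [? ?].
    have E2 m : complex.Im (f (m + n)%N x - f n x) = fi (m + n)%N x - fi n x.
      by rewrite -!fiE; case: (f (m + n)%N x) (f n x) => [? ?] [? ?].
    have E3 : complex.Re (v x - f n x) = vr x - fr n x.
      by rewrite -!frE /v; case: (f n x) => [? ?].
    have E4 : complex.Im (v x - f n x) = vi x - fi n x.
      by rewrite -!fiE /v; case: (f n x) => [? ?].
    rewrite E3 E4; under eq_fun do rewrite E1 E2.
    rewrite -(cvg_shiftn n) in c1; rewrite -(cvg_shiftn n) in c2.
    by apply: cvgD; under eq_fun do rewrite expr2; rewrite expr2; apply: cvgM; apply: cvgB => //;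
      exact: cvg_cst.
  apply: (le_trans (fatou _ _ mw w0)) => //.
  rewrite limn_einf_lim; apply: lime_le; first exact: is_cvg_einfs.
  apply: nearW => k; apply: le_trans (wint k).
  by apply: ereal_inf_lbound; exists k => /=.
have vf n : (fun x => v x - f n x) \in L2fun mu.
  by apply/L2funP; split=> //; apply: le_lt_trans (dist n) (ltry _).
have vL : v \in L2fun mu.
  have := rpredD (vf 0%N) (valP (repr (u 0%N))).
  by rewrite (_ : _ + _ = v)//; apply/funext => x; rewrite fctE subrK.
exists (pi (exist _ v vL)) => n.
rewrite -(reprK (u n)) -raddfB/=.
rewrite -ler_sqr ?nnegrE ?hnorm_ge0 ?mulr_ge0 ?exprn_ge0// -lee_fin hnorm_sqr_pi.
exact: dist.
Qed.

End completeness.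

(** * Orthogonal projections and adjoints *)

(** Closes the arguments below in which a quantity is bounded by an error c 2^-n for every n. *)
Lemma le0_geometric (R : realType) (x c : R) :
  (forall n, x <= c * 2^-1 ^+ n) -> x <= 0.
Proof.
move=> xc.
have h : (fun n => c * 2^-1 ^+ n) @ \oo --> (0 : R).
  by apply: (@cvg_geometric R c 2^-1); rewrite ger0_norm// invf_lt1// ltr1n.
rewrite -(cvg_lim _ h)//; apply: limr_ge; first exact: cvgP h.
exact: nearW.
Qed.

Lemma ge0_complexE (R : realType) (e : R[i]) : 0 <= e -> e = (complex.Re e)%:C%C.
Proof. by case: e => a b; rewrite lecE /= => /andP[/eqP -> _]. Qed.

Lemma gt0_complexE (R : realType) (e : R[i]) : 0 < e ->
  0 < complex.Re e /\ e = (complex.Re e)%:C%C.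
Proof.
move=> e0; have E := ge0_complexE (ltW e0); split=> //.
by move: e0; rewrite {1}E ltcR.
Qed.

Definition submodule (R : realType) (V : lmodType R[i]) (K : set V) :=
  K 0 /\ forall a u v, K u -> K v -> K (a *: u + v).

Section linear_ops.
Context (R : realType) (V W : lmodType R[i]) (S : V -> W).
Hypothesis lS : linear S.

Lemma linear_opD u v : S (u + v) = S u + S v.
Proof. by rewrite -[u in LHS]scale1r lS scale1r. Qed.

Lemma linear_op0 : S 0 = 0.
Proof. by apply: (addrI (S 0)); rewrite -linear_opD !addr0. Qed.

Lemma linear_opZ a u : S (a *: u) = a *: S u.
Proof. by rewrite -[a *: u]addr0 lS linear_op0 addr0. Qed.

Lemma linear_opB u v : S (u - v) = S u - S v.
Proof. by rewrite linear_opD -scaleN1r linear_opZ scaleN1r. Qed.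

Lemma linear_op_sum n (c : 'I_n -> R[i]) (u : 'I_n -> V) :
  S (\sum_(i < n) c i *: u i) = \sum_(i < n) c i *: S (u i).
Proof.
apply: (big_ind2 (fun x y => S x = y)); first exact: linear_op0.
- by move=> x1 x2 y1 y2 <- <-; rewrite linear_opD.
- by move=> i _; rewrite linear_opZ.
Qed.

End linear_ops.

Section span.
Context (R : realType) (V : normedModType R[i]).

Lemma lin_span_submodule (A : set V) : submodule (lin_span A).
Proof.
split.
  by exists 0%N, (fun=> 0), (fun=> 0); split; [case|rewrite big_ord0].
move=> a _ _ [n [c [w [wA ->]]]] [m [e [z [zA ->]]]].
exists (n + m)%N, (fun i : 'I_(n + m) => match fintype.split i with inl j => a * c j | inr j => e j end),
  (fun i : 'I_(n + m) => match fintype.split i with inl j => w j | inr j => z j end); split.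
  by move=> i; case: fintype.split.
rewrite big_split_ord scaler_sumr; congr (_ + _); apply: eq_bigr => i _.
  by rewrite (unsplitK (inl i : 'I_n + 'I_m)%type) scalerA.
by rewrite (unsplitK (inr i : 'I_n + 'I_m)%type).
Qed.

Lemma sub_lin_span (A : set V) : A `<=` lin_span A.
Proof.
move=> x Ax; exists 1%N, (fun=> 1), (fun=> x); split=> //.
by rewrite big_ord1 scale1r.
Qed.

Lemma lin_span_min (A K : set V) : submodule K -> A `<=` K -> lin_span A `<=` K.
Proof.
move=> [K0 KD] AK _ [n [c [w [wA ->]]]].
elim/big_ind: _ => // [x y Kx Ky|i _].
  by rewrite -[x]scale1r; exact: KD.
by rewrite -[_ *: _]addr0; apply: KD => //; exact/AK/wA.
Qed.

End span.

Section hilbert.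
Context d (T : measurableType d) (R : realType) (mu : {measure set T -> \bar R}).
Local Notation C := R[i].
Local Notation H := (L2 mu).
Implicit Types (u v w : H) (K : set H).

Lemma hnormZ a u : hnorm (a *: u) = cabs a * hnorm u.
Proof.
by apply: (@complexI R); rewrite rmorphM/= -!hnormE normrZ cabsC.
Qed.

Lemma hnorm_eq0 u : hnorm u = 0 -> u = 0.
Proof. by move=> u0; apply/eqP; rewrite -normr_eq0 hnormE u0. Qed.

Lemma hinner_le u v : cabs '[u, v] <= hnorm u * hnorm v.
Proof. by rewrite -lecR rmorphM/= cabsC -!hnormE inner_le. Qed.

Lemma hnorm_sqr u : '[u, u] = (hnorm u ^+ 2)%:C%C.
Proof. by rewrite innerxx hnormE rmorphXn. Qed.

Lemma closure_hnormP K u :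
  closure K u <-> forall e : R, 0 < e -> exists2 k, K k & hnorm (u - k) < e.
Proof.
split=> [cl e e0|cl B /nbhs_ballP[e /= e0 eB]].
  have [] := cl (ball u e%:C%C); first by apply: nbhsx_ballx; rewrite ltcR.
  move=> k [Kk]; rewrite -ball_normE /= hnormE ltcR => ke; by exists k.
have [e1 eE] := gt0_complexE e0.
have [k Kk ke] := cl _ e1; exists k; split=> //; apply: eB.
by rewrite -ball_normE /= hnormE eE ltcR.
Qed.

Lemma closure_inner_eq0 K w : (forall k, K k -> '[k, w] = 0) ->
  forall u, closure K u -> '[u, w] = 0.
Proof.
move=> K0 u /closure_hnormP cl; apply: cabs_eq0.
apply/eqP; rewrite eq_le cabs_ge0 andbT; apply: (@le0_geometric _ _ (hnorm w)) => n.
have [|k Kk /ltW uk] := cl (2^-1 ^+ n); first by rewrite exprn_gt0.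
rewrite -[u](subrK k) innerDl (K0 _ Kk) addr0 (le_trans (hinner_le _ _))//.
by rewrite mulrC ler_wpM2l ?hnorm_ge0.
Qed.

(** K need not be closed, so the foot p of the perpendicular lies in the closure. A minimizing
    sequence is nearly orthogonal to K by [near_minimizer_inner]; testing this against its own
    increments shows that it is Cauchy. *)
Lemma projection K : submodule K -> forall q,
  exists2 p, closure K p & forall k, K k -> '[q - p, k] = 0.
Proof.
move=> [K0 KD] q.
pose A := [set hnorm (q - k) ^+ 2 | k in K].
have hA : has_inf A.
  split; first by exists (hnorm (q - 0) ^+ 2), 0.
  by exists 0 => _ [k _ <-]; exact: sqr_ge0.
(* This error makes consecutive terms differ by at most 2^-n / 2 + 2^-(n+1) / 2 <= 2^-n, as
   [L2_fast_cauchy] requires. *)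
have ex n : exists k, K k /\ hnorm (q - k) ^+ 2 < inf A + (2^-1 ^+ n / 2) ^+ 2.
  have e0 : 0 < (2^-1 ^+ n / 2 : R) ^+ 2 by rewrite exprn_gt0// divr_gt0// exprn_gt0.
  have [_ [k Kk <-] kA] := inf_adherent e0 hA.
  by exists k.
have {ex}[k Hk] := choice ex.
have Kk n : K (k n) by have [] := Hk n.
have kperp n w : K w -> cabs '[q - k n, w] <= 2^-1 ^+ n / 2 * hnorm w.
  move=> Kw.
  rewrite -ler_sqr ?nnegrE ?cabs_ge0 ?mulr_ge0 ?hnorm_ge0 ?divr_ge0 ?exprn_ge0//.
  suff : `|'[q - k n, w]| ^+ 2 <= ((2^-1 ^+ n / 2) ^+ 2)%:C%C * `|w| ^+ 2.
    by rewrite -cabsC hnormE -!rmorphXn -rmorphM/= lecR -exprMn.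
  apply: near_minimizer_inner => t.
  rewrite -addrA -opprD !hnormE -!rmorphXn -rmorphB/= lecR lerBlDr.
  apply: (le_trans (ltW (proj2 (Hk n)))); rewrite lerD2r.
  apply: (ge_inf (proj2 hA)); exists (k n + t *: w) => //.
  by rewrite addrC; exact: KD.
have cauchy n : hnorm (k n.+1 - k n) <= 2^-1 ^+ n.
  set w := k n.+1 - k n.
  have Kw : K w by rewrite /w addrC -scaleN1r; exact: KD.
  have [w0|w0] := eqVneq (hnorm w) 0; first by rewrite w0 exprn_ge0.
  rewrite -(@ler_pM2r _ (hnorm w)) ?lt_neqAle ?hnorm_ge0 1?eq_sym ?w0//.
  rewrite -expr2.
  have -> : hnorm w ^+ 2 = cabs '[w, w].
    by rewrite hnorm_sqr; apply: (@complexI R); rewrite cabsC ger0_norm// lecR sqr_ge0.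
  rewrite {1}/w (_ : k n.+1 - k n = (q - k n) - (q - k n.+1)); last first.
    by rewrite opprB [RHS]addrC subrKA.
  rewrite innerBl; apply: (@le_trans _ _ (cabs '[q - k n, w] + cabs '[q - k n.+1, w])).
    by rewrite -lecR rmorphD/= !cabsC ler_normB.
  apply: (le_trans (lerD (kperp _ _ Kw) (kperp _ _ Kw))).
  rewrite -mulrDl ler_wpM2r ?hnorm_ge0// exprS.
  have : 0 <= (2^-1 : R) ^+ n by rewrite exprn_ge0.
  lra.
have [p Hp] := L2_fast_cauchy cauchy.
exists p.
  apply/closure_hnormP => e e0.
  apply: contrapT => /forall2NP nk.
  suff : e <= 0 by rewrite leNgt e0.
  apply: (@le0_geometric _ _ 2) => n; apply: le_trans (Hp n).
  by have [//|/negP] := nk (k n); rewrite -leNgt.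
move=> w Kw; apply: cabs_eq0; apply/eqP; rewrite eq_le cabs_ge0 andbT.
(* The two contributions are 2^-n / 2 from near orthogonality and 2 * 2^-n from |p - k n|. *)
apply: (@le0_geometric _ _ (3 * hnorm w)) => n.
rewrite (_ : q - p = (q - k n) - (p - k n)); last by rewrite opprB addrA subrK.
rewrite innerBl; apply: (@le_trans _ _ (cabs '[q - k n, w] + cabs '[p - k n, w])).
  by rewrite -lecR rmorphD/= !cabsC ler_normB.
apply: (le_trans (lerD (kperp _ _ Kw) (hinner_le _ _))).
rewrite -mulrDl [leRHS]mulrAC ler_wpM2r ?hnorm_ge0//.
have := Hp n; have : 0 <= (2^-1 : R) ^+ n by rewrite exprn_ge0.
lra.
Qed.

(** If l q is nonzero, the part z of q orthogonal to the kernel of l represents l up to a scalar. *)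
Lemma riesz (l : H -> C) (M : R) :
  (forall a u v, l (a *: u + v) = a * l u + l v) ->
  (forall u, cabs (l u) <= M * hnorm u) ->
  exists w, forall u, l u = '[u, w].
Proof.
move=> lin lM.
have l0 : l 0 = 0.
  by have := lin (-1) 0 0; rewrite scaler0 addr0 mulN1r addNr.
have lB u v : l (u - v) = l u - l v.
  by rewrite addrC -scaleN1r lin mulN1r addrC.
have [z|] := pselect (forall u, l u = 0).
  by exists 0 => u; rewrite z inner0r.
move=> /existsNP[q lq].
pose K := [set u | l u = 0].
have Ksub : submodule K.
  by split=> // a u v; rewrite /K /= => lu lv; rewrite lin lu lv mulr0 addr0.
have [p /closure_hnormP clp qp] := projection Ksub q.
have M0 : 0 <= `|M| by [].
(* p is only known to be in the closure of the kernel; the bound on l shows that it is in the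
   kernel. *)
have lp : l p = 0.
  apply: cabs_eq0; apply/eqP; rewrite eq_le cabs_ge0 andbT.
  apply: (@le0_geometric _ _ `|M|) => n.
  have [|k Kk /ltW pk] := clp (2^-1 ^+ n); first by rewrite exprn_gt0.
  rewrite -[l p]subr0 -[X in _ - X]Kk -lB (le_trans (lM _))//.
  apply: (@le_trans _ _ (`|M| * hnorm (p - k))).
    by rewrite ler_wpM2r ?hnorm_ge0// ler_norm.
  by rewrite ler_wpM2l.
set z := q - p; have lz : l z = l q by rewrite /z lB lp subr0.
exists ((l z / '[z, z])^* *: z) => u.
have zz0 : '[z, z] != 0.
  by apply/eqP => /inner_eq0 z0; apply: lq; rewrite -lz z0.
(* The vector on the left is in the kernel of l, to which z is orthogonal. *)
have : '[u - (l u / l z) *: z, z] = 0.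
  rewrite innerC qp ?rmorph0// /K /= lB -[_ *: z]addr0 lin l0 addr0.
  by rewrite -mulrA mulVf ?mulr1 ?subrr// lz; apply/eqP.
rewrite innerBl innerZl innerZr conjCK => /eqP; rewrite subr_eq0 => /eqP ->.
rewrite [RHS]mulrC -mulrA (mulrCA '[z, z]) divff// mulr1.
by rewrite -mulrA mulVf ?mulr1// lz; apply/eqP.
Qed.

End hilbert.

Section bounded_ops.
Context (R : realType).
Context d1 (T1 : measurableType d1) (m1 : {measure set T1 -> \bar R}).
Context d2 (T2 : measurableType d2) (m2 : {measure set T2 -> \bar R}).

Lemma bounded_opP (S : L2 m1 -> L2 m2) : bounded_op S <->
  linear S /\ exists2 M : R, 0 < M & forall u, hnorm (S u) <= M * hnorm u.
Proof.
split=> [[lS [M SM]]|[lS [M M0 SM]]]; split=> //; last first.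
  by exists M%:C%C => u; rewrite !hnormE -rmorphM/= lecR.
(* The given bound M is a complex number; its modulus is a real bound, and adding 1 makes it
   positive. *)
exists (cabs M + 1) => [|u]; first by rewrite ltr_pwDr// cabs_ge0.
rewrite mulrDl mul1r -[leLHS]addr0 lerD ?hnorm_ge0//.
rewrite -lecR rmorphM/= cabsC -!hnormE (le_trans (SM u))//.
have MSu : 0 <= M * `|u| by apply: le_trans (SM u).
by rewrite -[leLHS]ger0_norm// normrM normr_id.
Qed.

(** A relation between functions; existence is [adj_exists], and linearity and boundedness of S'
    follow in [is_adj_bounded]. *)
Definition is_adj (S : L2 m1 -> L2 m2) (S' : L2 m2 -> L2 m1) :=
  forall u v, '[S u, v] = '[u, S' v].

Lemma adj_exists (S : L2 m1 -> L2 m2) : bounded_op S ->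
  exists S', is_adj S S'.
Proof.
move=> /bounded_opP[lS [M M0 SM]].
suff /choice[S' HS'] : forall v, exists w, forall u, '[S u, v] = '[u, w].
  by exists S' => u v; exact: HS'.
move=> v; apply: (@riesz _ _ _ _ _ (M * hnorm v)).
  by move=> a u w; rewrite lS innerDl innerZl.
move=> u; apply: (le_trans (hinner_le _ _)).
by rewrite mulrAC ler_wpM2r ?hnorm_ge0.
Qed.

End bounded_ops.

Section adjoint_bounded.
Context (R : realType).
Context d1 (T1 : measurableType d1) (m1 : {measure set T1 -> \bar R}).
Context d2 (T2 : measurableType d2) (m2 : {measure set T2 -> \bar R}).

Lemma is_adjC (S : L2 m1 -> L2 m2) S' : is_adj S S' -> is_adj S' S.
Proof. by move=> SS' u v; rewrite innerC -SS' -innerC. Qed.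

Lemma is_adj_le (S : L2 m1 -> L2 m2) S' (M : R) : 0 <= M -> is_adj S S' ->
  (forall u, hnorm (S u) <= M * hnorm u) -> forall v, hnorm (S' v) <= M * hnorm v.
Proof.
move=> M0 SS' SM v.
have [z|z] := eqVneq (hnorm (S' v)) 0.
  by rewrite z mulr_ge0 ?hnorm_ge0.
rewrite -(@ler_pM2l _ (hnorm (S' v))) ?lt_neqAle ?hnorm_ge0 1?eq_sym ?z//.
rewrite -expr2 (_ : _ ^+ 2 = cabs '[S' v, S' v]); last first.
  by rewrite hnorm_sqr; apply: (@complexI R); rewrite cabsC ger0_norm// lecR sqr_ge0.
rewrite -SS' (le_trans (hinner_le _ _))// mulrA ler_wpM2r ?hnorm_ge0//.
by rewrite mulrC.
Qed.

Lemma is_adj_bounded (S : L2 m1 -> L2 m2) S' : bounded_op S -> is_adj S S' ->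
  bounded_op S'.
Proof.
move=> /bounded_opP[lS [M M0 SM]] SS'; apply/bounded_opP; split.
  by move=> a u v; apply: inner_ext => w; rewrite innerDr innerZr -!SS' innerDr innerZr.
by exists M => //; exact: is_adj_le (ltW M0) SS' SM.
Qed.

End adjoint_bounded.

Section bounded_comp.
Context (R : realType) (U V W : normedModType R[i]).

Lemma bounded_op0 : bounded_op (0 : U -> V).
Proof.
split; first by move=> a u v; change (0 = a *: 0 + 0 :> V); rewrite scaler0 addr0.
by exists 0 => u; rewrite mul0r; change (`|0 : V| <= 0); rewrite normr0.
Qed.

Lemma bounded_opZD a (S T : U -> V) : bounded_op S -> bounded_op T ->
  bounded_op (a *: S + T).
Proof.
move=> [lS [M SM]] [lT [N TN]]; split.
  move=> b u v; rewrite !fctE lS lT !scalerDr !scalerA (mulrC a b).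
  by rewrite -!addrA; congr (_ + _); rewrite addrCA.
exists (`|a| * M + N) => u; rewrite fctE (le_trans (ler_normD _ _))//.
by rewrite mulrDl lerD// normrZ -mulrA ler_wpM2l.
Qed.

Lemma bounded_op_comp (S : V -> W) (T : U -> V) : bounded_op S -> bounded_op T ->
  bounded_op (S \o T).
Proof.
move=> [lS [M SM]] [lT [N TN]]; split.
  by move=> b u v; rewrite /= lT lS.
exists (`|M| * N) => u; rewrite /= (le_trans (SM _))//.
apply: (@le_trans _ _ (`|M| * `|T u|)); last by rewrite -mulrA ler_wpM2l.
have := le_trans (normr_ge0 _) (SM (T u)).
by move=> /ger0_norm <-; rewrite normrM normr_id.
Qed.

End bounded_comp.

(** * Multiplication operators *)

Lemma ae_forall_nat d (T : measurableType d) (R : realType)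
    (mu : {measure set T -> \bar R}) (P : nat -> T -> Prop) :
  (forall n, \forall x \ae mu, P n x) -> \forall x \ae mu, forall n, P n x.
Proof.
move=> aeP.
apply: (@negligibleS _ _ _ mu (\bigcup_n ~` [set x | P n x])); last exact: negligible_bigcup.
by move=> x /existsNP[n nP]; exists n.
Qed.

Section multiplication.
Context d (T : measurableType d) (R : realType) (mu : {measure set T -> \bar R}).
Local Notation C := R[i].
Local Notation H := (L2 mu).
Local Notation pi := (\pi_(L2 mu)%qT : L2fun_type mu -> L2 mu).
Implicit Types (u v : H) (phi : T -> C).

Definition L2repr (u : H) : T -> C := \val (repr u).

Lemma L2repr_mem u : L2repr u \in L2fun mu.
Proof. exact: valP. Qed.

Lemma L2repr_measurable u : cmeasurable (L2repr u).
Proof. exact: L2fun_measurable. Qed.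

Lemma L2_ext u v : (\forall x \ae mu, L2repr u x = L2repr v x) -> u = v.
Proof.
move=> uv; rewrite -[u]reprK -[v]reprK; apply/L2_eqP.
by apply: filterS uv => x + _.
Qed.

Lemma L2_of_fun (f : T -> C) : f \in L2fun mu ->
  exists u, \forall x \ae mu, L2repr u x = f x.
Proof.
move=> fL; exists (pi (exist _ f fL)).
by apply: filterS (repr_pi_ae (exist _ f fL : L2fun_type mu)) => x; exact.
Qed.

Lemma L2repr_linear a u v :
  \forall x \ae mu, L2repr (a *: u + v) x = a * L2repr u x + L2repr v x.
Proof.
rewrite -[u in X in \forall x \ae _, X x = _]reprK -[v in X in \forall x \ae _, X x = _]reprK.
rewrite [a *: _]L2scale_pi -L2piD.
by apply: filterS (repr_pi_ae (a *: repr u + repr v)) => x; exact.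
Qed.

Lemma L2repr0 : \forall x \ae mu, L2repr (0 : H) x = 0.
Proof.
have <- : pi 0 = 0 by exact: raddf0.
by apply: filterS (repr_pi_ae (0 : L2fun_type mu)) => x; exact.
Qed.

Lemma hnorm_integral u :
  ((hnorm u) ^+ 2)%:E = (\int[mu]_x ((cabs (L2repr u x)) ^+ 2)%:E)%E.
Proof. by rewrite -[u in LHS]reprK hnorm_sqr_pi. Qed.

Lemma inner_integral (u v : H) :
  '[u, v] = cintegral mu (fun x => L2repr u x * (L2repr v x)^*).
Proof. by []. Qed.

Lemma inner_integrable (u v : H) : cintegrable mu (fun x => L2repr u x * (L2repr v x)^*).
Proof. exact: cintegrable_mul_conj. Qed.

Lemma L2class_ae (f : T -> C) : f \in L2fun mu ->
  \forall x \ae mu, L2repr (L2class mu f) x = f x.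
Proof.
move=> fL; rewrite -[f]/(\val (exist _ f fL : L2fun_type mu)) L2classE.
by apply: filterS (repr_pi_ae (exist _ f fL : L2fun_type mu)) => x; exact.
Qed.

Lemma mulop_ae phi u : cLfun mu +oo%E phi ->
  \forall x \ae mu, L2repr (mulop phi u) x = phi x * L2repr u x.
Proof. by move=> phioo; apply: L2class_ae; apply: mulop_L2fun => //; exact: L2repr_mem. Qed.

Lemma cLfunoo_bounded phi : cLfun mu +oo%E phi ->
  exists2 M : R, 0 <= M & \forall x \ae mu, cabs (phi x) <= M.
Proof.
move=> [/Lfunoo_bounded[M M0 HM] /Lfunoo_bounded[N N0 HN]].
exists (M + N); first exact: addr_ge0.
apply: filterS2 HM HN => x Mx Nx.
by apply: (le_trans (cabs_le _)); exact: lerD.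
Qed.

Lemma bounded_cLfunoo phi (M : R) : cmeasurable phi ->
  (\forall x \ae mu, cabs (phi x) <= M) -> cLfun mu +oo%E phi.
Proof.
move=> [m1 m2] phiM.
have K (g : T -> R) : measurable_fun setT g -> (forall x, `|g x| <= cabs (phi x)) ->
    g \in Lfun mu +oo%E.
  move=> mg gphi; rewrite inE; apply/andP; split; rewrite inE//= /finite_norm unlock.
  case: ifPn => // _; apply: (@le_lt_trans _ _ M%:E); last exact: ltry.
  apply/ess_supP; apply: filterS phiM => x phix /=.
  by rewrite lee_fin (le_trans (gphi x)).
split; apply: K => // x; rewrite cabsE -sqrtr_sqr ler_sqrt ?addr_ge0 ?sqr_ge0//=.
  by rewrite lerDl sqr_ge0.
by rewrite lerDr sqr_ge0.
Qed.

Lemma hnorm_le_mul u v (M : R) : 0 <= M ->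
  (\forall x \ae mu, cabs (L2repr u x) <= M * cabs (L2repr v x)) ->
  hnorm u <= M * hnorm v.
Proof.
move=> M0 uv; rewrite -ler_sqr ?nnegrE ?mulr_ge0 ?hnorm_ge0// exprMn -lee_fin (EFinM (M ^+ 2)).
rewrite !hnorm_integral -ge0_integralZl//.
- apply: ae_ge0_le_integral => //.
  + by move=> x _; rewrite lee_fin sqr_ge0.
  + exact/measurable_cabs_sqr/L2repr_measurable.
  + by move=> x _; rewrite -EFinM lee_fin mulr_ge0 ?sqr_ge0.
  + apply: measurable_funeM.
    exact/measurable_cabs_sqr/L2repr_measurable.
  apply: filterS uv => x + _; rewrite -EFinM lee_fin -exprMn.
  by rewrite ler_sqr ?nnegrE ?mulr_ge0 ?cabs_ge0.
- exact/measurable_cabs_sqr/L2repr_measurable.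
- by move=> x _; rewrite lee_fin sqr_ge0.
- by rewrite lee_fin sqr_ge0.
Qed.

Lemma mulop_bounded phi : cLfun mu +oo%E phi -> bounded_op (mulop phi : H -> H).
Proof.
move=> phioo; apply/bounded_opP; split.
  move=> a u v; apply: L2_ext.
  apply: filterS2 (filterI (mulop_ae u phioo) (mulop_ae v phioo))
    (filterI (mulop_ae (a *: u + v) phioo)
       (filterI (L2repr_linear a u v) (L2repr_linear a (mulop phi u) (mulop phi v)))).
  by move=> x [E1 E2] [-> [-> ->]]; rewrite E1 E2 mulrDr mulrCA.
have [M M0 HM] := cLfunoo_bounded phioo.
exists (M + 1) => [|u]; first by rewrite ltr_pwDr.
apply: hnorm_le_mul; first exact: addr_ge0.
apply: filterS2 HM (mulop_ae u phioo) => x Mx ->.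
by rewrite cabsM ler_wpM2r ?cabs_ge0// ler_wpDr.
Qed.

Lemma mulop_comm phi psi u : cLfun mu +oo%E phi -> cLfun mu +oo%E psi ->
  mulop phi (mulop psi u) = mulop psi (mulop phi u).
Proof.
move=> p1 p2; apply: L2_ext.
apply: filterS2 (filterI (mulop_ae u p1) (mulop_ae u p2))
  (filterI (mulop_ae (mulop psi u) p1) (mulop_ae (mulop phi u) p2)).
by move=> x [E1 E2] [-> ->]; rewrite E1 E2 mulrCA.
Qed.

Lemma cLfun_cindic (A : set T) : measurable A -> cLfun mu +oo%E (cindic R A).
Proof.
move=> mA; apply: (@bounded_cLfunoo _ 1).
  split.
    rewrite (_ : _ \o _ = \1_A :> (T -> R)); first exact: measurable_indic.
    exact/funext.
  rewrite (_ : _ \o _ = cst 0 :> (T -> R)); first exact: measurable_cst.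
  exact/funext.
apply: nearW => x; rewrite cabsE /cindic /= expr0n addr0 sqrtr_sqr.
by rewrite indicE; case: (x \in A); rewrite ?normr1 ?normr0.
Qed.

Lemma cindic_ae (A : set T) u : measurable A ->
  \forall x \ae mu, L2repr (mulop (cindic R A) u) x = (x \in A)%:R * L2repr u x.
Proof.
move=> mA; apply: filterS (mulop_ae u (cLfun_cindic mA)) => x ->.
by rewrite /cindic indicE; case: (x \in A).
Qed.

Lemma cindic_bounded (A : set T) : measurable A ->
  bounded_op (mulop (cindic R A) : H -> H).
Proof. by move=> /cLfun_cindic; exact: mulop_bounded. Qed.

Lemma cindic_setI (A B : set T) u : measurable A -> measurable B ->
  mulop (cindic R A) (mulop (cindic R B) u) = mulop (cindic R (A `&` B)) u.
Proof.
move=> mA mB; apply: L2_ext.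
apply: filterS2 (cindic_ae u mB)
  (filterI (cindic_ae (mulop (cindic R B) u) mA) (cindic_ae u (measurableI _ _ mA mB))).
move=> x E [-> ->]; rewrite E in_setI.
by case: (x \in A); rewrite ?mul1r ?mul0r.
Qed.

Lemma cindic_adj (A : set T) : measurable A ->
  is_adj (mulop (cindic R A) : H -> H) (mulop (cindic R A)).
Proof.
move=> mA u v; rewrite !inner_integral.
apply: eq_ae_cintegral; [exact: inner_integrable..|].
apply: filterS2 (cindic_ae u mA) (cindic_ae v mA) => x /= -> -> _.
by rewrite rmorphM/= rmorph_nat mulrCA mulrA.
Qed.

(** Passes from the pieces of a countable cover to the whole set; it is applied to the covers given
    by Lusin's theorem. *)
Lemma cindic_cover_eq0 (A : set T) (K : (set T)^nat) u :
  measurable A -> (forall n, measurable (K n)) -> mu (A `\` \bigcup_n K n) = 0 ->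
  (forall n, mulop (cindic R (K n)) u = 0) -> mulop (cindic R A) u = 0.
Proof.
move=> mA mK AK Ku; apply: L2_ext.
have aeN : \forall x \ae mu, ~ (A `\` \bigcup_n K n) x.
  exists (A `\` \bigcup_n K n); split=> //; last by move=> x /= /contrapT.
  by apply: measurableD => //; exact: bigcupT_measurable.
have allK : \forall x \ae mu, forall n, L2repr (mulop (cindic R (K n)) u) x =
    (x \in K n)%:R * L2repr u x.
  by apply: ae_forall_nat => n; exact: cindic_ae.
apply: filterS2 (filterI aeN allK) (filterI (cindic_ae u mA) L2repr0).
move=> x [Nx Kx] [-> z]; rewrite z.
have [xA|xA] := boolP (x \in A); last by rewrite mul0r.
have [n _ Knx] : (\bigcup_n K n) x.
  by apply: contrapT => nK; apply: Nx; split=> //; exact: set_mem.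
by have := Kx n; rewrite Ku z mem_set// !mul1r => <-.
Qed.

Lemma mulop_linear phi : cLfun mu +oo%E phi -> linear (mulop phi : H -> H).
Proof. by move=> /mulop_bounded[]. Qed.

Lemma cindic_subset (A B : set T) u : measurable A -> measurable B -> A `<=` B ->
  mulop (cindic R A) (mulop (cindic R B) u) = mulop (cindic R A) u.
Proof. by move=> mA mB /setIidPl AB; rewrite cindic_setI// AB. Qed.

End multiplication.

Lemma measurable_funV_ge0 d (T : measurableType d) (R : realType) (f : T -> R) :
  measurable_fun setT f -> (forall x, 0 <= f x) ->
  measurable_fun setT (fun x => (f x)^-1).
Proof.
move=> mf f0; rewrite (_ : (fun _ => _) = (fun x => f x `^ (-1))).
  exact: (measurableT_comp (measurable_powR _) mf).
by apply/funext => x; rewrite powR_inv1.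
Qed.

Lemma measurable_fun_sqrt d (T : measurableType d) (R : realType) (f : T -> R) :
  measurable_fun setT f -> measurable_fun setT (fun x => Num.sqrt (f x)).
Proof.
move=> mf; apply: (measurableT_comp _ mf).
by apply: continuous_measurable_fun; exact: sqrt_continuous.
Qed.

Lemma cabs_nat (R : realType) n : cabs (n%:R : R[i]) = n%:R.
Proof. by apply: (@complexI R); rewrite cabsC normr_nat rmorph_nat. Qed.

Lemma cabs_real (R : realType) (x : R) : 0 <= x -> cabs x%:C%C = x.
Proof. by move=> x0; rewrite cabsE /= expr0n addr0 sqrtr_sqr ger0_norm. Qed.

(** * The commutant of the characteristic functions *)

Section masa.
Context d (T : measurableType d) (R : realType).
Local Notation C := R[i].

Lemma cintegral_ae_eq (mu : {measure set T -> \bar R}) (k l : T -> C) :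
  cintegrable mu k -> cintegrable mu l ->
  (forall E, measurable E ->
    cintegral mu (fun x => (x \in E)%:R * k x) = cintegral mu (fun x => (x \in E)%:R * l x)) ->
  \forall x \ae mu, k x = l x.
Proof.
move=> [k1 k2] [l1 l2] kl.
(* p stands for the real or the imaginary part, so that the real-valued uniqueness theorem is
   applied once. *)
have key (p : C -> R) : (forall (b : bool) z, p (b%:R * z) = b%:R * p z) ->
    (forall E, measurable E -> (\int[mu]_x p (((x \in E)%:R : C) * k x) =
       \int[mu]_x p (((x \in E)%:R : C) * l x))%R) ->
    mu.-integrable setT (EFin \o (p \o k)) -> mu.-integrable setT (EFin \o (p \o l)) ->
    \forall x \ae mu, p (k x) = p (l x).
  move=> pM pE ik il.
  suff : ae_eq mu setT (EFin \o (p \o k)) (EFin \o (p \o l)).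
    by apply: filterS => x /(_ I) [].
  apply: integral_ae_eq => //; first exact: measurable_int il.
  move=> E _ mE.
  rewrite -[LHS]fineK ?integrable_fin_num//; last exact: integrableS ik.
  rewrite -[RHS]fineK ?integrable_fin_num//; last exact: integrableS il.
  congr EFin; rewrite (integral_mkcond E (EFin \o (p \o k))) (integral_mkcond E (EFin \o (p \o l))).
  have restrE (h : T -> C) : (EFin \o (p \o h)) \_ E =
      (fun x => (p (((x \in E)%:R : C) * h x))%:E).
    by apply/funext => x; rewrite /patch pM; case: (x \in E); rewrite ?mul1r ?mul0r.
  by rewrite !restrE; exact: pE.
have ReM (b : bool) (z : C) : complex.Re (b%:R * z) = b%:R * complex.Re z.
  by case: b; rewrite ?mul1r ?mul0r.
have ImM (b : bool) (z : C) : complex.Im (b%:R * z) = b%:R * complex.Im z.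
  by case: b; rewrite ?mul1r ?mul0r.
have H1 := key (@complex.Re R) ReM (fun E mE => congr1 (@complex.Re R) (kl E mE)) k1 l1.
have H2 := key (@complex.Im R) ImM (fun E mE => congr1 (@complex.Im R) (kl E mE)) k2 l2.
by apply: filterS2 H1 H2 => x; case: (k x) (l x) => [? ?] [? ?] /= -> ->.
Qed.

(** The square root of a weighted sum of indicators of an exhausting sequence of sets of finite
    measure. *)
Lemma strictly_positive_L2 (mu : {sigma_finite_measure set T -> \bar R}) :
  exists r : T -> R, [/\ measurable_fun setT r, forall x, 0 <= r x,
    \forall x \ae mu, 0 < r x & (fun x => (r x)%:C%C) \in L2fun mu].
Proof.
have [F FT HF] := sigma_finiteT mu.
have mF n : measurable (F n) by have [] := HF n.
(* The n-th term then has integral at most 2^-(n+1), and the added 1 keeps the denominator positive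
   on null sets. *)
pose c n : R := 1 / (2 ^ n.+1)%:R / (1 + fine (mu (F n))).
have muF0 n : 0 <= fine (mu (F n)) by exact: fine_ge0.
have c0 n : 0 < c n.
  by rewrite divr_gt0 ?ltr_pwDl// divr_gt0// ltr0n expn_gt0.
pose t n x := (c n * \1_(F n) x)%:E.
have t0 n x : (0 <= t n x)%E by rewrite lee_fin mulr_ge0// ltW.
have mt n : measurable_fun setT (t n).
  by apply/measurable_EFinP; apply: measurable_funM => //; exact: measurable_indic.
pose g x := (\sum_(0 <= n <oo) t n x)%E.
have mg : measurable_fun setT g.
  by apply: ge0_emeasurable_sum.
have g0 x : (0 <= g x)%E by exact: nneseries_ge0.
have ig : mu.-integrable setT g.
  apply/integrableP; split => //; under eq_integral do rewrite gee0_abs//.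
  rewrite integral_nneseries//; apply: (@le_lt_trans _ _ 1%:E); last exact: ltry.
  apply: (le_trans _ (@epsilon_trick0 R 1 xpredT _)) => //.
  apply: lee_nneseries => n _; first by move=> _; exact: integral_ge0.
  under eq_integral do rewrite /t EFinM.
  rewrite ge0_integralZl//; last 2 first.
  - by apply/measurable_EFinP; exact: measurable_indic.
  - by rewrite lee_fin ltW.
  rewrite integral_indic// setIT -[X in (_ * X)%E]fineK; last first.
    by rewrite ge0_fin_numE//; have [] := HF n.
  rewrite -EFinM lee_fin /c -[leLHS]mulrA ler_piMr// ?divr_ge0//.
  by rewrite mulrC ler_pdivrMr ?mul1r ?ltr_pwDl// lerDr.
pose r x := Num.sqrt (fine (g x)).
have mfg : measurable_fun setT (fun x => fine (g x)) by exact: measurableT_comp.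
have aeg := integrable_ae measurableT ig.
exists r; split.
- exact: measurable_fun_sqrt.
- by move=> x; exact: sqrtr_ge0.
- apply: filterS aeg => x /(_ I) gx; rewrite sqrtr_gt0 -lte_fin fineK//.
  have [n _ Fn] : (\bigcup_n F n) x by rewrite -FT.
  apply: (@lt_le_trans _ _ (t n x)).
    by rewrite lte_fin indicE mem_set// mulr1.
  apply: le_trans (nneseries_lim_ge n.+1 _) => //.
  by rewrite big_nat_recr//= leeDr// sume_ge0.
apply/L2funP; split.
  split; first exact: measurable_fun_sqrt.
  exact: measurable_cst.
have /integrableP[_] := ig; apply: le_lt_trans.
apply: ae_ge0_le_integral => //.
- by move=> x _; rewrite lee_fin sqr_ge0.
- apply: measurable_cabs_sqr; split; first exact: measurable_fun_sqrt.
  exact: measurable_cst.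
- exact: measurableT_comp.
apply: filterS aeg => x /(_ I) gx _.
rewrite gee0_abs// cabs_sqr /= expr0n addr0 sqr_sqrtr ?fine_ge0//.
by rewrite fineK.
Qed.

(* D acts as multiplication by conj (D* e) / e for any e > 0 in L2: the identity
   <D (1_E u), e> = <1_E u, D* e> for all E says that (D u) conj e = u conj (D* e). *)
Lemma masa (mu : {sigma_finite_measure set T -> \bar R}) (D : L2 mu -> L2 mu) :
  bounded_op D ->
  (forall A, measurable A -> forall u, D (mulop (cindic R A) u) = mulop (cindic R A) (D u)) ->
  exists2 phi, cLfun mu +oo%E phi & forall u, D u = mulop phi u.
Proof.
move=> bD DA.
have [D' DD'] := adj_exists bD.
have [r [mr r0 aer rL]] := strictly_positive_L2 mu.
have [e ee] := L2_of_fun rL.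
have key u v : \forall x \ae mu,
    L2repr (D u) x * (L2repr v x)^* = L2repr u x * (L2repr (D' v) x)^*.
  apply: cintegral_ae_eq; [exact: inner_integrable..|].
  have E1 (w z : L2 mu) A : measurable A -> '[mulop (cindic R A) w, z] =
      cintegral mu (fun x => (x \in A)%:R * (L2repr w x * (L2repr z x)^*)).
    move=> mA; rewrite inner_integral.
    have inte : cintegrable mu (fun x => (x \in A)%:R * (L2repr w x * (L2repr z x)^*)).
      have [i1 i2] := inner_integrable w z.
      split.
        rewrite (_ : _ \o _ = (EFin \o (fun x => complex.Re (L2repr w x * (L2repr z x)^*))) \_ A).
          by apply/(integrable_mkcond _ mA)/(integrableS measurableT).
        by apply/funext => x; rewrite /patch /=; case: (x \in A); rewrite ?mul1r ?mul0r.
      rewrite (_ : _ \o _ = (EFin \o (fun x => complex.Im (L2repr w x * (L2repr z x)^*))) \_ A).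
        by apply/(integrable_mkcond _ mA)/(integrableS measurableT).
      by apply/funext => x; rewrite /patch /=; case: (x \in A); rewrite ?mul1r ?mul0r.
    apply: eq_ae_cintegral => //; first exact: inner_integrable.
    by apply: filterS (cindic_ae w mA) => x -> _; rewrite mulrA.
  by move=> A mA; rewrite -!E1// -DA// DD'.
pose phi x := (L2repr (D' e) x)^* * ((r x)^-1)%:C%C.
have mrV : measurable_fun setT (fun x => (r x)^-1) by exact: measurable_funV_ge0.
have Dphi u : \forall x \ae mu, L2repr (D u) x = phi x * L2repr u x.
  apply: filterS2 (filterI aer ee) (key u e) => x [rx ->].
  have rxC : (r x)%:C%C != 0 by rewrite eq_complex /= eqxx andbT gt_eqF.
  rewrite (_ : ((r x)%:C%C)^* = (r x)%:C%C); last first.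
    by apply/eqP; rewrite eq_complex /= oppr0 !eqxx.
  move=> /(congr1 (fun z => z / (r x)%:C%C)); rewrite mulfK// => ->.
  by rewrite /phi fmorphV/= mulrC mulrA mulrAC (mulrC (_^-1)) -mulrA mulrC mulrAC.
have mphi : cmeasurable phi.
  have [m1 m2] := L2repr_measurable (D' e); split.
    rewrite (_ : _ \o _ = (fun x => complex.Re (L2repr (D' e) x) * (r x)^-1)).
      exact: measurable_funM.
    by apply/funext => x; rewrite /phi /=; case: (L2repr (D' e) x) => a b /=; ring.
  rewrite (_ : _ \o _ = (fun x => - complex.Im (L2repr (D' e) x) * (r x)^-1)).
    by apply: measurable_funM => //; exact: measurableT_comp.
  by apply/funext => x; rewrite /phi /=; case: (L2repr (D' e) x) => a b /=; ring.
have /bounded_opP[_ [M M0 DM]] := bD.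
have phiM : \forall x \ae mu, cabs (phi x) <= M.
  (* For u = 1_B e, the excess |D u|^2 - M^2 |u|^2 is the integral of the nonnegative function [G].
     The bound on D forces this integral to be 0, so G vanishes almost everywhere, and B is null
     because e > 0. *)
  pose B := [set x | M < cabs (phi x)].
  have mB : measurable B.
    rewrite -[B]setTI; apply: (measurable_fun_ltr _ _ measurableT) => //.
    by have [? ?] := mphi; exact: measurable_cabs.
  pose G x := \1_B x * (cabs (phi x) ^+ 2 - M ^+ 2) * cabs (L2repr e x) ^+ 2.
  have mphi2 : measurable_fun setT (fun x => cabs (phi x) ^+ 2).
    by apply: measurable_funX; have [? ?] := mphi; exact: measurable_cabs.
  have mG : measurable_fun setT (EFin \o G).
    apply/measurable_EFinP; apply: measurable_funM.
      apply: measurable_funM; first exact: measurable_indic.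
      by apply: measurable_funB => //; exact: measurable_cst.
    by apply/measurable_EFinP/measurable_cabs_sqr/L2repr_measurable.
  have G0 x : 0 <= G x.
    rewrite /G indicE; have [xB|_] := boolP (x \in B); last by rewrite !mul0r.
    rewrite mul1r mulr_ge0 ?sqr_ge0// subr_ge0 ler_sqr ?nnegrE ?cabs_ge0//; last exact: ltW.
    by apply/ltW; move/set_mem: xB.
  pose u := mulop (cindic R B) e.
  have msq v : measurable_fun setT (fun x => (cabs (L2repr v x) ^+ 2)%:E).
    exact/measurable_cabs_sqr/L2repr_measurable.
  have sq0 v x : (0 <= (cabs (L2repr v x) ^+ 2)%:E)%E by rewrite lee_fin sqr_ge0.
  have uB := cindic_ae e mB.
  have split_sq : (\int[mu]_x (cabs (L2repr (D u) x) ^+ 2)%:E =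
      \int[mu]_x ((M ^+ 2)%:E * (cabs (L2repr u x) ^+ 2)%:E + (G x)%:E))%E.
    apply: ae_eq_integral => //.
      by apply: emeasurable_funD => //; exact: measurable_funeM.
    apply: filterS2 (Dphi u) uB => x -> ux _.
    rewrite ux (cabsM (phi x)) (cabsM ((x \in B)%:R)) -EFinM -EFinD; congr EFin; rewrite /G indicE.
    rewrite cabs_nat; case: (x \in B) => /=; last by rewrite !mul0r !mulr0 expr0n mulr0 addr0.
    by rewrite !mul1r; ring.
  have intG : (\int[mu]_x (G x)%:E = 0)%E.
    have : (hnorm (D u) ^+ 2)%:E = ((M ^+ 2)%:E * (hnorm u ^+ 2)%:E +
        \int[mu]_x (G x)%:E)%E.
      rewrite !hnorm_integral split_sq ge0_integralD//.
      - by rewrite ge0_integralZl// lee_fin sqr_ge0.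
      - by move=> x _; rewrite mule_ge0// lee_fin sqr_ge0.
      - exact: measurable_funeM.
      - by move=> x _; rewrite lee_fin.
    have : (0 <= \int[mu]_x (G x)%:E)%E by apply: integral_ge0 => x _; rewrite lee_fin.
    case: (\int[mu]_x (G x)%:E)%E => [s| |]//.
    rewrite lee_fin -EFinM -EFinD => s0 [hs]; congr EFin; apply/eqP.
    rewrite eq_le s0 andbT.
    have : hnorm (D u) ^+ 2 <= (M * hnorm u) ^+ 2.
      by rewrite ler_sqr ?nnegrE ?mulr_ge0 ?hnorm_ge0// ltW.
    by rewrite hs exprMn gerDl.
  have /(ae_eq_integral_abs mu measurableT mG) G00 : (\int[mu]_x `|(G x)%:E| = 0)%E.
    by rewrite -[RHS]intG; apply: eq_integral => x _; rewrite gee0_abs// lee_fin.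
  apply: filterS2 (filterI aer ee) G00 => x [rx ex] /(_ I) [Gx].
  rewrite leNgt; apply/negP => Mphi; move: Gx.
  rewrite /G indicE mem_set// mul1r => /eqP; rewrite mulf_eq0 sqrf_eq0 subr_eq0.
  rewrite ex cabs_real ?ltW// (gt_eqF rx) orbF.
  by rewrite eqrXn2 ?cabs_ge0// ?ltW// gt_eqF.
exists phi; first exact: bounded_cLfunoo phiM.
move=> u; apply: L2_ext.
by apply: filterS2 (Dphi u) (mulop_ae u (bounded_cLfunoo mphi phiM)) => x -> ->.
Qed.

End masa.

(** * Intertwiners *)

(** Bundles a set function given by a formula into a finite measure, to which the Radon-Nikodym
    theorem applies. *)
Lemma finite_measure_exists d (T : measurableType d) (R : realType)
    (m : set T -> \bar R) : m set0 = 0%E -> (forall A, (0 <= m A)%E) ->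
  semi_sigma_additive m -> fin_num_fun m ->
  exists la : {finite_measure set T -> \bar R}, forall A, la A = m A.
Proof.
move=> m0 mge0 madd mfin.
pose M1 := isMeasure.Build d T R m m0 mge0 madd.
pose m1 : {measure set T -> \bar R} := HB.pack m M1.
pose M2 := Measure_isFinite.Build d T R m1 mfin.
pose m2 : {finite_measure set T -> \bar R} := HB.pack m M1 M2.
by exists m2.
Qed.

Section transfer.
Context d (X : measurableType d) d1 (X1 : measurableType d1) (R : realType).
Variables (mu : {sigma_finite_measure set X -> \bar R}).
Variables (mu1 : {sigma_finite_measure set X1 -> \bar R}).
Variables (theta : X -> X1) (mtheta : measurable_fun setT theta).
Hypothesis theta_ac : pushforward mu theta `<< mu1.

Lemma measurable_preimageT A : measurable A -> measurable (theta @^-1` A).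
Proof. by move=> mA; rewrite -[_ @^-1` _]setTI; exact: mtheta. Qed.

Lemma pushforward_null A : measurable A -> mu1 A = 0%E -> mu (theta @^-1` A) = 0%E.
Proof.
move=> mA A0; have /measure0_null_setP : (mu1 : {measure set X1 -> \bar R}) A = 0%E by [].
by move=> /(_ mA)/theta_ac/(_ A mA); apply.
Qed.

Lemma pushforward_ae (P : X1 -> Prop) :
  (\forall y \ae mu1, P y) -> \forall x \ae mu, P (theta x).
Proof.
move=> [N [mN N0 PN]]; exists (theta @^-1` N); split.
- exact: measurable_preimageT.
- exact: pushforward_null.
- by move=> x /= nP; apply: PN.
Qed.

(** h is the density of theta_*(w mu) with respect to mu1; it exists because the preimage of a
    mu1-null set is mu-null, hence null for w mu. *)
Lemma transfer_density (w : X -> R) : measurable_fun setT w -> (forall x, 0 <= w x) ->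
  (\int[mu]_x (w x)%:E < +oo)%E ->
  exists h : X1 -> R, [/\ measurable_fun setT h, forall y, 0 <= h y &
    forall g : X1 -> \bar R, measurable_fun setT g -> (forall y, 0 <= g y)%E ->
      (\int[mu]_x (g (theta x) * (w x)%:E) = \int[mu1]_y (g y * (h y)%:E))%E].
Proof.
move=> mw w0 woo.
have mwE : measurable_fun setT (EFin \o w) by exact/measurable_EFinP.
have w0E x : (0 <= (EFin \o w) x)%E by rewrite lee_fin.
have iw : mu.-integrable setT (EFin \o w).
  apply/integrableP; split=> //; apply: le_lt_trans woo.
  by rewrite le_eqVlt; apply/orP; left; apply/eqP; apply: eq_integral => x _; rewrite gee0_abs.
have [nuw Hnu] : exists nuw : {finite_measure set X -> \bar R},
    forall A, nuw A = (\int[mu]_(x in A) (EFin \o w) x)%E.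
  apply: finite_measure_exists.
  - exact: integral_set0.
  - by move=> A; exact: integral_ge0.
  - exact: semi_sigma_additive_nng_induced.
  - by move=> A mA; apply: integrable_fin_num => //; exact: integrableS iw.
have [la Hla] : exists la : {finite_measure set X1 -> \bar R},
    forall A, la A = nuw (theta @^-1` A).
  apply: finite_measure_exists.
  - by rewrite preimage_set0 measure0.
  - by move=> A; exact: measure_ge0.
  - exact: (@measure_semi_sigma_additive _ _ _ (pushforward nuw theta)).
  - by move=> A mA; apply: fin_num_measure; exact: measurable_preimageT.
have nu_ac : nuw `<< mu.
  apply/null_content_dominatesP => A mA A0; rewrite Hnu.
  by apply: null_set_integral => //; exact: measurable_funTS.
have la_ac : la `<< mu1.
  apply/null_content_dominatesP => A mA A0; rewrite Hla.
  move/null_content_dominatesP : nu_ac; apply; first exact: measurable_preimageT.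
  exact: pushforward_null.
pose h1 := Radon_Nikodym_SigmaFinite.f la mu1.
(* The density of w mu is w almost everywhere; expressing it as a derivative makes the change of
   variables formula available on X as well. *)
pose k := Radon_Nikodym_SigmaFinite.f nuw mu.
have h1fin y : h1 y \is a fin_num by exact: Radon_Nikodym_SigmaFinite.f_fin_num.
have h10 y : (0 <= h1 y)%E by exact: Radon_Nikodym_SigmaFinite.f_ge0.
have ih1 : mu1.-integrable setT h1 by exact: Radon_Nikodym_SigmaFinite.f_integrable.
have ik : mu.-integrable setT k by exact: Radon_Nikodym_SigmaFinite.f_integrable.
have kw : ae_eq mu setT k (EFin \o w).
  apply: integral_ae_eq => // E _ mE.
  by rewrite -Radon_Nikodym_SigmaFinite.f_integral// Hnu.
exists (fun y => fine (h1 y)); split.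
- by apply: measurableT_comp => //; exact: measurable_int ih1.
- by move=> y; exact: fine_ge0.
move=> g mg g0.
have mgt : measurable_fun setT (g \o theta) by exact: measurableT_comp.
transitivity (\int[mu]_x ((g \o theta) x * k x))%E.
  apply: ae_eq_integral => //.
  - exact: emeasurable_funM.
  - by apply: emeasurable_funM => //; exact: measurable_int ik.
  - by apply: filterS kw => x /= kx _; rewrite kx.
rewrite (Radon_Nikodym_SigmaFinite.change_of_variables nu_ac)//; last first.
  by move=> x; exact: g0.
under [RHS]eq_integral do rewrite fineK//.
rewrite (Radon_Nikodym_SigmaFinite.change_of_variables la_ac)//.
transitivity (\int[pushforward nuw theta]_y g y)%E; last first.
  by apply: eq_measure_integral => A mA _; exact/esym/Hla.
rewrite ge0_integral_pushforward//.
Qed.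

End transfer.

Section cmeasurable_ops.
Context d (T : measurableType d) (R : realType).

Lemma cmeasurableM (f g : T -> R[i]) : cmeasurable f -> cmeasurable g ->
  cmeasurable (fun x => f x * g x).
Proof.
move=> [f1 f2] [g1 g2]; split.
  rewrite (_ : _ \o _ = ((@complex.Re R \o f) \* (@complex.Re R \o g)) \-
    ((@complex.Im R \o f) \* (@complex.Im R \o g)))%R.
    by apply: measurable_funB; exact: measurable_funM.
  by apply/funext => x /=; case: (f x) (g x) => [? ?] [? ?].
rewrite (_ : _ \o _ = ((@complex.Re R \o f) \* (@complex.Im R \o g)) \+
    ((@complex.Im R \o f) \* (@complex.Re R \o g)))%R.
  by apply: measurable_funD; exact: measurable_funM.
by apply/funext => x /=; case: (f x) (g x) => [? ?] [? ?].
Qed.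

Lemma cmeasurable_real (f : T -> R) : measurable_fun setT f ->
  cmeasurable (fun x => (f x)%:C%C).
Proof. by move=> mf; split=> //; exact: measurable_cst. Qed.

Lemma cmeasurable_comp d' (T' : measurableType d') (h : T' -> T) (f : T -> R[i]) :
  measurable_fun setT h -> cmeasurable f -> cmeasurable (f \o h).
Proof.
by move=> mh [f1 f2]; split; [exact: (measurableT_comp f1 mh)|exact: (measurableT_comp f2 mh)].
Qed.

End cmeasurable_ops.

Section intertwiner.
Context d (X : measurableType d) d1 (X1 : measurableType d1) (R : realType).
Variables (mu : {measure set X -> \bar R}) (mu1 : {measure set X1 -> \bar R}).
Variable theta : X -> X1.

Definition intertwiner (A : L2 mu1 -> L2 mu) := bounded_op A /\
  forall B, measurable B -> forall u,
    A (mulop (cindic R B) u) = mulop (cindic R (theta @^-1` B)) (A u).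

End intertwiner.
Arguments intertwiner {d X d1 X1 R mu mu1} theta A.

Section intertwiner_theory.
Context d (X : measurableType d) d1 (X1 : measurableType d1) (R : realType).
Variables (mu : {sigma_finite_measure set X -> \bar R}).
Variables (mu1 : {sigma_finite_measure set X1 -> \bar R}).
Variables (theta : X -> X1) (mtheta : measurable_fun setT theta).
Hypothesis theta_ac : pushforward mu theta `<< mu1.

(* [s] is 0 where h = 0, by the convention 0^-1 = 0; this is harmless because xi vanishes
   almost everywhere on theta^-1 {h = 0}. *)
Lemma intertwiner_exists (xi : L2 mu) : exists A f,
  [/\ intertwiner theta A, A f = xi & forall A' : L2 mu -> L2 mu1, is_adj A A' -> A' xi = f].
Proof.
pose w x := cabs (L2repr xi x) ^+ 2.
have mw : measurable_fun setT w.
  exact/measurable_EFinP/measurable_cabs_sqr/L2repr_measurable.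
have w0 x : 0 <= w x by exact: sqr_ge0.
have woo : (\int[mu]_x (w x)%:E < +oo)%E by rewrite -hnorm_integral ltry.
have [h [mh h0 hE]] := transfer_density mtheta theta_ac mw w0 woo.
pose s y := (Num.sqrt (h y))^-1.
have s0 y : 0 <= s y by rewrite invr_ge0 sqrtr_ge0.
have ms : measurable_fun setT s.
  by apply: measurable_funV_ge0; [exact: measurable_fun_sqrt|move=> y; exact: sqrtr_ge0].
have s2h y : s y ^+ 2 * h y <= 1.
  rewrite /s exprVn sqr_sqrtr//.
  by have [->|?] := eqVneq (h y) 0; [rewrite mulr0|rewrite mulVf].
pose F (u : L2 mu1) x := L2repr xi x * ((s (theta x))%:C%C * L2repr u (theta x)).
have mF u : cmeasurable (F u).
  apply: cmeasurableM; first exact: L2repr_measurable.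
  apply: (cmeasurable_comp mtheta (f := fun y => (s y)%:C%C * L2repr u y)).
  by apply: cmeasurableM; [exact: cmeasurable_real|exact: L2repr_measurable].
(* The left side is the integral of s^2 |u|^2 h over X1, and s^2 h <= 1. Hence A is a
   contraction. *)
have intF u : (\int[mu]_x (cabs (F u x) ^+ 2)%:E <= (hnorm u ^+ 2)%:E)%E.
  pose g y := (s y ^+ 2 * cabs (L2repr u y) ^+ 2)%:E.
  have mg : measurable_fun setT g.
    have : measurable_fun setT (fun y => s y ^+ 2 * cabs (L2repr u y) ^+ 2).
      apply: measurable_funM; first exact: measurable_funX.
      exact/measurable_EFinP/measurable_cabs_sqr/L2repr_measurable.
    by move/measurable_EFinP.
  have g0 y : (0 <= g y)%E by rewrite lee_fin mulr_ge0 ?sqr_ge0.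
  have -> : (\int[mu]_x (cabs (F u x) ^+ 2)%:E = \int[mu]_x (g (theta x) * (w x)%:E))%E.
    apply: eq_integral => x _; rewrite -EFinM; congr EFin.
    by rewrite /F !cabsM cabs_real// !exprMn /w mulrC.
  rewrite hE// hnorm_integral; apply: ge0_le_integral => //.
  - by move=> y _; rewrite mule_ge0// lee_fin.
  - by apply: emeasurable_funM => //; exact/measurable_EFinP.
  - exact/measurable_cabs_sqr/L2repr_measurable.
  move=> y _; rewrite -EFinM lee_fin mulrAC -[leRHS]mul1r.
  by rewrite ler_wpM2r ?sqr_ge0.
have FL u : F u \in L2fun mu.
  by apply/L2funP; split=> //; apply: le_lt_trans (intF u) (ltry _).
pose A (u : L2 mu1) : L2 mu := L2class mu (F u).
have Aae u : \forall x \ae mu, L2repr (A u) x = F u x by exact: L2class_ae.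
have A1 u : hnorm (A u) <= hnorm u.
  rewrite -ler_sqr ?nnegrE ?hnorm_ge0// -lee_fin.
  apply: le_trans (intF u); rewrite hnorm_integral le_eqVlt; apply/orP; left; apply/eqP.
  apply: ae_eq_integral => //; [|exact: measurable_cabs_sqr|].
    exact/measurable_cabs_sqr/L2repr_measurable.
  by apply: filterS (Aae u) => x ->.
have bA : bounded_op A.
  apply/bounded_opP; split; last by exists 1 => // u; rewrite mul1r.
  move=> a u v; apply: L2_ext.
  apply: filterS2 (filterI (Aae u) (Aae v)) (filterI (Aae (a *: u + v))
   (filterI (L2repr_linear a (A u) (A v)) (pushforward_ae mtheta theta_ac (L2repr_linear a u v)))).
  move=> x [Eu Ev] [-> [-> E]]; rewrite Eu Ev /F E.
  by ring.
have tA : intertwiner theta A.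
  split=> // B mB u; apply: L2_ext.
  apply: filterS2 (filterI (Aae (mulop (cindic R B) u)) (Aae u))
    (filterI (cindic_ae (A u) (measurable_preimageT mtheta mB))
     (pushforward_ae mtheta theta_ac (cindic_ae u mB))).
  move=> x [-> Eu] [-> E]; rewrite Eu /F E.
  have -> : (x \in theta @^-1` B) = (theta x \in B) by [].
  by ring.
(* The density formula with g = 1; it shows that f = sqrt h has the same norm as xi. *)
have hoo : (\int[mu1]_y (h y)%:E = \int[mu]_x (w x)%:E)%E.
  have := hE (cst 1%E) (measurable_cst _) (fun=> lee01).
  by under eq_integral do rewrite mul1e; under [RHS]eq_integral do rewrite mul1e.
pose f0 y := (Num.sqrt (h y))%:C%C.
have cf0 y : cabs (f0 y) ^+ 2 = h y by rewrite cabs_real ?sqrtr_ge0// sqr_sqrtr.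
have f0L : f0 \in L2fun mu1.
  apply/L2funP; split; first exact/cmeasurable_real/measurable_fun_sqrt.
  by under eq_integral do rewrite cf0; rewrite hoo.
have [f fE] := L2_of_fun f0L.
have nf : hnorm f ^+ 2 = hnorm xi ^+ 2.
  suff : (hnorm f ^+ 2)%:E = (hnorm xi ^+ 2)%:E by case.
  rewrite !hnorm_integral -hoo; apply: ae_eq_integral => //.
  - exact/measurable_cabs_sqr/L2repr_measurable.
  - exact/measurable_EFinP.
  by apply: filterS fE => y -> _; rewrite cf0.
have Af : A f = xi.
  (* The density formula with g the indicator of Z shows that |xi|^2 has integral 0 over theta^-1
     Z. *)
  pose Z := [set y | h y = 0].
  have mZ : measurable Z by rewrite -[Z]setTI; exact: (mh measurableT [set 0]).
  have ind0 y : (0 <= (\1_Z y : R)%:E)%E by rewrite lee_fin.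
  have mind : measurable_fun setT (fun y => (\1_Z y : R)%:E).
    by apply/measurable_EFinP; exact: measurable_indic.
  have := hE (fun y => (\1_Z y : R)%:E) mind ind0.
  rewrite [RHS]integral0_eq; last first.
    move=> y _; rewrite -EFinM indicE; have [yZ|_] := boolP (y \in Z); last by rewrite mul0r.
    by rewrite (set_mem yZ) mulr0.
  rewrite (_ : (\int[mu]_x _)%E = (\int[mu]_x `|(\1_Z (theta x) : R)%:E * (w x)%:E|)%E); last first.
    by apply: eq_integral => x _; rewrite gee0_abs// mule_ge0// lee_fin.
  have mm : measurable_fun setT (fun x => (\1_Z (theta x) : R)%:E * (w x)%:E)%E.
    apply: emeasurable_funM; last exact/measurable_EFinP.
    exact: (measurableT_comp mind mtheta).
  move=> /(ae_eq_integral_abs mu measurableT mm) z.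
  apply: L2_ext; apply: filterS2 (filterI (Aae f) (pushforward_ae mtheta theta_ac fE)) z.
  move=> x [-> E] /(_ I); rewrite /F E /f0 -EFinM indicE => -[].
  rewrite -rmorphM/= /s.
  have [hx|hx] := eqVneq (h (theta x)) 0.
    rewrite mem_set// mul1r => /eqP; rewrite /w sqrf_eq0 => /eqP/cabs_eq0 ->.
    by rewrite mul0r.
  by move=> _; rewrite mulVf ?mulr1// sqrtr_eq0 -ltNge lt_neqAle eq_sym hx h0.
exists A, f; split=> // A' AA'.
have nA' : hnorm (A' xi) <= hnorm xi.
  rewrite -[leRHS]mul1r; apply: (is_adj_le ler01 AA') => u.
  by rewrite mul1r.
(* Since |f| = |xi| and <f, A' xi> = |xi|^2, expanding gives |A' xi - f|^2 = |A' xi|^2 - |xi|^2,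
   which is at most 0 because A' is a contraction. *)
apply/eqP; rewrite -subr_eq0; apply/eqP/hnorm_eq0/eqP.
rewrite -sqrf_eq0 eq_le sqr_ge0 andbT -lecR -hnorm_sqr.
have fE1 : '[f, A' xi] = '[xi, xi] by rewrite -[in RHS]Af -AA' Af.
rewrite innerBl !innerBr fE1 [ '[A' xi, f] ]innerC fE1.
rewrite !hnorm_sqr nf (_ : ((hnorm xi ^+ 2)%:C%C)^* = (hnorm xi ^+ 2)%:C%C); last first.
  by apply/eqP; rewrite eq_complex /= oppr0 !eqxx.
rewrite subrr subr0 -rmorphB/= lecR subr_le0.
by rewrite ler_sqr ?nnegrE ?hnorm_ge0.
Qed.

End intertwiner_theory.

(** * Compact sets with compact images *)

Section lusin.
Context (R : realType).

Lemma separable_countable_base (Y : completeMetricType R) : separable Y ->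
  exists U : nat -> set Y, (forall n, open (U n)) /\
    forall y N, nbhs y N -> exists2 n, U n y & U n `<=` N.
Proof.
move=> [D /countable_injP[f finj] dD].
(* The code n of (i, k) names the open ball of radius 1/(k+1) around the point of D with index i. As
   f is injective on D, the union has at most one term; it is empty if no point has index i. *)
pose U n : set Y := if @choice.unpickle (nat * nat)%type n is Some (i, k) then
  \bigcup_(a in [set a | D a /\ f a = i]) (ball a k.+1%:R^-1)^° else set0.
exists U; split=> [n|y N /nbhs_ballP[e /= e0 eN]].
  rewrite /U; case: choice.unpickle => [[i k]|]; last exact: open0.
  by apply: bigcup_open => a _; exact: open_interior.
have [k ke] : exists k, (k.+1%:R^-1 : R) < e / 2.
  have [k] := near_infty_natSinv_lt (PosNum (divr_gt0 e0 (ltr0n _ 2 : (0 : R) < 2))).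
  by move=> _ /(_ k (leqnn k)) /= ?; exists k.
have k0 : (0 : R) < k.+1%:R^-1 by rewrite invr_gt0.
(* A dense point a within r of y has y in its ball of radius 2 r, and this ball lies within 3 r < e
   of y. *)
pose r : R := k.+1%:R^-1 / 2.
have r0 : 0 < r by rewrite divr_gt0.
have [a [ya Da]] : (ball y r)^° `&` D !=set0.
  apply: dD; last exact: open_interior.
  by exists y; apply: nbhsx_ballx.
exists (choice.pickle (f a, k)).
  rewrite /U choice.pickleK; exists a => //.
  apply/nbhs_ballP; exists r => //= z yz.
  rewrite [k.+1%:R^-1]splitr; apply: ball_triangle yz.
  by apply: ball_sym; exact: interior_subset ya.
rewrite /U choice.pickleK => z [b [Db fb] bz].
have {fb}ba : b = a by apply: finj; rewrite ?inE.
apply: eN; apply: (@le_ball _ _ _ (r + k.+1%:R^-1)).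
  by rewrite /r; move: ke e0; move: (k.+1%:R^-1) => q; lra.
apply: (ball_triangle (y := a)); first exact: interior_subset ya.
by rewrite -ba; exact: interior_subset bz.
Qed.

Variable X : completeMetricType R.
Implicit Types K : set X.

Lemma compact_measurable K : compact K -> measurable (K : set (borel X)).
Proof.
move=> cK; have clK : closed K by apply: compact_closed => //; exact: metric_hausdorff.
rewrite -[K]setCK; apply: measurableC; apply: sub_sigma_algebra.
exact: closed_openC.
Qed.

Variable mu : {sigma_finite_measure set (borel X) -> \bar R}.
Hypothesis rmu : regular_measure mu.

Lemma inner_compact (A : set (borel X)) (e : R) : measurable A -> (mu A < +oo)%E ->
  0 < e -> exists K, [/\ compact K, K `<=` A & (mu (A `\` K) <= e%:E)%E].
Proof.
move=> mA Aoo e0.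
have Afin : mu A \is a fin_num by rewrite ge0_fin_numE.
have [muA _] := rmu mA.
have muA' := muA; rewrite muA' in Afin.
have [_ [K [cK KA] <-]] := ub_ereal_sup_adherent e0 Afin.
rewrite -muA => muK; exists K; split=> //.
have mK := compact_measurable cK.
rewrite measureD// (_ : A `&` K = K); last exact/setIidPr.
have Kfin : mu K \is a fin_num.
  by rewrite ge0_fin_numE// (le_lt_trans _ Aoo)// le_measure ?inE.
by rewrite leeBlDr// addeC -leeBlDr// ltW.
Qed.

Variable X1 : completeMetricType R.
Hypothesis sepX1 : separable X1.
Variable theta : borel X -> borel X1.
Hypothesis mtheta : measurable_fun setT theta.

(* On K, the intersection of the C_n `|` C'_n below, the preimage of each basic open set U n
   is relatively open, so theta is continuous on K. *)
Lemma lusin_compact (A : set (borel X)) (e : R) : measurable A -> (mu A < +oo)%E ->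
  0 < e -> exists K, [/\ compact K, K `<=` A, compact (theta @` K : set X1) &
    (mu (A `\` K) <= e%:E)%E].
Proof.
move=> mA Aoo e0.
have [U [oU baseU]] := separable_countable_base sepX1.
have mU n : measurable (theta @^-1` U n).
  by rewrite -[_ @^-1` _]setTI; apply: mtheta => //; exact: sub_sigma_algebra.
pose en n : R := e / (2 ^ n.+1)%:R.
have en0 n : 0 < en n by rewrite divr_gt0// ltr0n expn_gt0.
have fin B : measurable B -> B `<=` A -> (mu B < +oo)%E.
  by move=> mB BA; rewrite (le_lt_trans _ Aoo)// le_measure ?inE.
(* C_n and C'_n approximate from inside the parts of A where theta is in U n and where it is not,
   each with half of the error [en n]. *)
have exC n : exists CC : set X * set X, [/\ compact CC.1, compact CC.2,
    CC.1 `<=` A `&` theta @^-1` U n, CC.2 `<=` A `\` theta @^-1` U n &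
    (mu (A `\` (CC.1 `|` CC.2)) <= (en n)%:E)%E].
  have mI := measurableI _ _ mA (mU n).
  have mD := measurableD mA (mU n).
  have en2 : 0 < en n / 2 by rewrite divr_gt0.
  have [C [cC CA muC]] := inner_compact mI (fin _ mI (@subIsetl _ _ _)) en2.
  have [C' [cC' CA' muC']] := inner_compact mD (fin _ mD (@subDsetl _ _ _)) en2.
  exists (C, C'); split=> //=.
  have mC := compact_measurable cC; have mC' := compact_measurable cC'.
  apply: (@le_trans _ _ (mu (((A `&` theta @^-1` U n) `\` C) `|` ((A `\` theta @^-1` U n) `\` C')))).
    apply: le_measure; rewrite ?inE.
    - by apply: measurableD => //; exact: measurableU.
    - by apply: measurableU; exact: measurableD.
    move=> x [Ax nC]; have [Ux|Ux] := pselect ((theta @^-1` U n) x).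
      by left; split=> // Cx; apply: nC; left.
    by right; split=> // Cx; apply: nC; right.
  apply: (le_trans (measureU2 _ _ _)); [exact: measurableD..|].
  by rewrite (splitr (en n)) EFinD leeD.
have [CC HC] := choice exC.
pose K := \bigcap_n ((CC n).1 `|` (CC n).2).
have cCC n : compact ((CC n).1 `|` (CC n).2).
  by have [? ? _ _ _] := HC n; exact: compactU.
have clK : closed K.
  by apply: closed_bigI => n _; apply: compact_closed => //; exact: metric_hausdorff.
have cK : compact K.
  by apply: (subclosed_compact clK (cCC 0%N)) => x; apply.
exists K; split=> //.
- move=> x /(_ 0%N I); have [_ _ C1 C2 _] := HC 0%N.
  by move=> [/C1[]|/C2[]].
- apply: (@continuous_compact X X1) => //.
  (* If theta x is in U n, then x is outside the closed set C'_n; the points of K near x are outside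
     it too, hence in C_n, and theta maps them into U n. *)
  apply/subspace_continuousP => x Kx N Nx.
  have [n Ux UN] := baseU _ _ Nx.
  have [c1 c2 C1 C2 _] := HC n.
  have nC2 : ~ (CC n).2 x by move=> /C2[_]; apply.
  have oC2 : open (~` (CC n).2).
    by apply: closed_openC; apply: compact_closed => //; exact: metric_hausdorff.
  have : nbhs x (~` (CC n).2) by exact: open_nbhs_nbhs.
  rewrite /nbhs /= /within /=; apply: filterS => z nC2z Kz.
  by apply: UN; have [/C1[_ //]|//] := Kz n I.
apply: (@le_trans _ _ (\sum_(0 <= n <oo) mu (A `\` ((CC n).1 `|` (CC n).2)))%E).
  have mC n : measurable (A `\` ((CC n).1 `|` (CC n).2) : set (borel X)).
    by apply: measurableD => //; exact: compact_measurable.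
  apply: measure_sigma_subadditive => //.
    by apply: measurableD => //; exact: compact_measurable.
  move=> x [Ax nK]; apply: contrapT => h; apply: nK => n _.
  by apply: contrapT => nC; apply: h; exists n.
apply: le_trans (@epsilon_trick0 R e xpredT (ltW e0)).
apply: lee_nneseries => [n _ _|n _]; first exact: measure_ge0.
by have [] := HC n.
Qed.

(** Apply [lusin_compact] to every piece A [&] F m of finite measure with every error 1/(k+1). The
    images are compact, hence closed and Borel. *)
Lemma lusin_cover (A : set (borel X)) : measurable A ->
  exists K : nat -> set (borel X), [/\ forall n, measurable (K n), forall n, K n `<=` A,
    forall n, measurable (theta @` K n) & mu (A `\` \bigcup_n K n) = 0%E].
Proof.
move=> mA.
have [F FT HF] := sigma_finiteT mu.
have mF n : measurable (F n) by have [] := HF n.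
have mAF n : measurable (A `&` F n) by exact: measurableI.
have AFoo n : (mu (A `&` F n) < +oo)%E.
  by have [_] := HF n; apply: le_lt_trans; rewrite le_measure ?inE.
have ex (p : nat * nat) : exists K, [/\ compact K, K `<=` A `&` F p.1,
    compact (theta @` K : set X1) &
    (mu ((A `&` F p.1) `\` K) <= (p.2.+1%:R^-1)%:E)%E].
  by apply: lusin_compact => //; rewrite invr_gt0.
have [K HK] := choice ex.
have mK p : measurable (K p : set (borel X)).
  by have [? _ _ _] := HK p; exact: compact_measurable.
(* The pairs are enumerated by their codes; a number that codes no pair contributes the empty
   set. *)
pose L n : set (borel X) := if @choice.unpickle (nat * nat)%type n is Some p then K p else set0.
have LE p : L (choice.pickle p) = K p by rewrite /L choice.pickleK.
exists L; split=> [n|n|n|].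
- by rewrite /L; case: choice.unpickle.
- rewrite /L; case: choice.unpickle => [p|]; last exact: sub0set.
  by have [_ KA _ _] := HK p; apply: subset_trans KA _; exact: subIsetl.
- rewrite /L; case: choice.unpickle => [p|]; last by rewrite image_set0.
  have [_ _ cK _] := HK p.
  have clK := compact_closed (@metric_hausdorff _ X1) cK.
  rewrite -[_ @` _]setCK; apply: measurableC; apply: sub_sigma_algebra.
  exact: closed_openC.
have mL n : measurable (L n) by rewrite /L; case: choice.unpickle.
have mAL : measurable (A `\` \bigcup_n L n).
  by apply: measurableD => //; exact: bigcupT_measurable.
apply/(measure0_null_setP mu mAL)/negligible_null_set.
have : mu.-negligible (\bigcup_m ((A `&` F m) `\` \bigcup_n L n)).
  apply: negligible_bigcup => m; exists ((A `&` F m) `\` \bigcup_n L n); split=> //.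
    by apply: measurableD => //; exact: bigcupT_measurable.
  apply/eqP; rewrite eq_le measure_ge0 andbT; apply/lee_addgt0Pr => e e0; rewrite add0e.
  have [k ke] : exists k, (k.+1%:R^-1 : R) < e.
    by have [k _ /(_ k (leqnn k)) /= ?] := near_infty_natSinv_lt (PosNum e0); exists k.
  have [_ _ _ muK] := HK (m, k).
  apply: (@le_trans _ _ (k.+1%:R^-1)%:E); last by rewrite lee_fin ltW.
  apply: le_trans muK; apply: le_measure; rewrite ?inE.
  - by apply: measurableD => //; exact: bigcupT_measurable.
  - exact: measurableD.
  move=> x [AFx nL]; split=> // Kx; apply: nL.
  by exists (choice.pickle (m, k)) => //; rewrite LE.
apply: negligibleS => x [Ax nL].
have [m _ Fx] : (\bigcup_n F n) x by rewrite -FT.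
by exists m.
Qed.

End lusin.

(** * The weak* topology *)

Lemma cvg_initialP (S : choiceType) (T : topologicalType) (f : S -> T)
    (F : set_system S) (s : S) : Filter F ->
  F --> (s : initial_topology f) <-> f @ F --> f s.
Proof.
move=> FF; split=> [Fs A fsA|fFs A].
  by apply: Fs; exact: (@initial_continuous _ _ f s).
move=> [_ [[B oB <-] Bs] BA]; apply: filterS BA _.
by apply: fFs; exact: open_nbhs_nbhs.
Qed.

Lemma cvg_ptwsP (I : Type) (T : topologicalType) (F : set_system {ptws I -> T})
    (f : {ptws I -> T}) : Filter F ->
  F --> f <-> forall i, (fun g : {ptws I -> T} => g i) @ F --> f i.
Proof.
move=> FF; split=> [/cvg_sup Ff i|Ff]; first exact/(cvg_initialP (fun g : forall i, T => g i))/Ff.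
by apply/cvg_sup => i; apply/(cvg_initialP (fun g : forall i, T => g i)); exact: Ff.
Qed.

Section real_complex_cvg.
Context (R : realType).

Lemma cvg_real_complex (u : R^nat) (l : R) :
  u @ \oo --> l <-> (fun n => (u n)%:C%C) @ \oo --> (l%:C%C : R[i]).
Proof.
split=> [ul|ul]; apply/cvgrPdist_lt => e e0.
  have [e1 eE] := gt0_complexE e0.
  move/cvgrPdist_lt : ul => /(_ _ e1); apply: filterS => n.
  by rewrite -rmorphB/= -cabsC eE ltcR cabsE /= expr0n addr0 sqrtr_sqr.
have eC : 0 < e%:C%C :> R[i] by rewrite ltcR.
move/cvgrPdist_lt : ul => /(_ _ eC); apply: filterS => n.
by rewrite -rmorphB/= -cabsC ltcR cabsE /= expr0n addr0 sqrtr_sqr.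
Qed.

Lemma cvg_Re (u : R[i]^nat) (l : R[i]) :
  u @ \oo --> l -> (fun n => complex.Re (u n)) @ \oo --> complex.Re l.
Proof.
move=> ul; apply/cvgrPdist_lt => e e0.
have eC : 0 < e%:C%C :> R[i] by rewrite ltcR.
move/cvgrPdist_lt : ul => /(_ _ eC); apply: filterS => n.
rewrite -cabsC ltcR; apply: le_lt_trans.
rewrite cabsE -sqrtr_sqr ler_sqrt ?addr_ge0 ?sqr_ge0//.
by case: l (u n) => [a b] [c d] /=; rewrite lerDl sqr_ge0.
Qed.

Lemma is_cvg_series_real_complex (u : R^nat) :
  cvgn (series u) <-> cvgn (series (fun n => (u n)%:C%C : R[i])).
Proof.
have E : series (fun n => (u n)%:C%C : R[i]) = (fun n => (series u n)%:C%C).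
  by apply/funext => n; rewrite !seriesEord /= rmorph_sum.
rewrite E; split=> [cu|/cvg_Re cu]; last exact: cvgP cu.
by have /cvg_real_complex := cu; exact: cvgP.
Qed.

End real_complex_cvg.

Section summable.
Context d (T : measurableType d) (R : realType) (mu : {measure set T -> \bar R}).

Lemma square_summableP (xi : (L2 mu)^nat) :
  square_summable xi <-> cvgn (series (fun k => hnorm (xi k) ^+ 2)).
Proof.
rewrite is_cvg_series_real_complex /square_summable.
by under eq_fun do rewrite hnormE -rmorphXn.
Qed.

(** With (u, 0, 0, ...) and (v, 0, 0, ...) the weak* pairing of T is <T u, v>. *)
Lemma square_summable_single (u : L2 mu) :
  square_summable (fun k => if k == 0%N then u else 0).
Proof.
apply/square_summableP.
suff /cvgP : series (fun k => hnorm (if k == 0%N then u else 0) ^+ 2) @ \oo --> hnorm u ^+ 2 by [].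
apply: cvg_near_cst.
exists 1%N => // n /= n1; rewrite seriesEord /= -(prednK n1) big_ord_recl /=.
by rewrite big1 ?addr0// => i _; rewrite hnorm0 expr0n.
Qed.

End summable.

Lemma square_summable_comp d (T : measurableType d) d' (T' : measurableType d') (R : realType)
    (mu : {measure set T -> \bar R}) (mu' : {measure set T' -> \bar R})
    (A : L2 mu -> L2 mu') (xi : (L2 mu)^nat) :
  bounded_op A -> square_summable xi -> square_summable (fun k => A (xi k)).
Proof.
move=> /bounded_opP[_ [M M0 AM]] /square_summableP cxi; apply/square_summableP.
apply: (@series_le_cvg _ _ (fun k => M ^+ 2 * hnorm (xi k) ^+ 2)).
- by move=> k; exact: sqr_ge0.
- by move=> k; rewrite mulr_ge0 ?sqr_ge0.
- by move=> k; rewrite -exprMn ler_sqr ?nnegrE ?mulr_ge0 ?hnorm_ge0// ltW.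
exact: is_cvg_seriesZ.
Qed.

Section weakstar.
Context d1 d2 (X : measurableType d1) (Y : measurableType d2) (R : realType).
Variables (mu : {measure set X -> \bar R}) (nu : {measure set Y -> \bar R}).
Local Notation op := (L2 mu -> L2 nu).
Implicit Types (T : op) (U : set op).

Definition weakstar_idx (xi : (L2 mu)^nat) (eta : (L2 nu)^nat)
    (sxi : square_summable xi) (seta : square_summable eta) : weakstar_index mu nu :=
  exist (fun p : (L2 mu)^nat * (L2 nu)^nat => square_summable p.1 /\ square_summable p.2)
    (xi, eta) (conj sxi seta).

Definition weakstar_closure U : set op :=
  closure (U : set (initial_topology (@weakstar_pairing _ _ X Y R mu nu))).

(** The topology is initial for the pairings, so limits of filters can be tested on each pairing
    separately. *)
Lemma weakstar_closureP U T : weakstar_closure U T <->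
  exists F : set_system op, [/\ ProperFilter F, F U &
    forall p, (fun S => weakstar_pairing S p) @ F --> weakstar_pairing T p].
Proof.
rewrite /weakstar_closure closureEcvg; split.
  move=> [F FF [FT FU]]; exists F; split=> //; first exact: FU.
  by move/cvg_initialP : FT => /cvg_ptwsP FT p; exact: FT.
move=> [F [FF FU FT]]; exists F => //; split.
  by apply/cvg_initialP/cvg_ptwsP => p; exact: FT.
by move=> A UA; apply: filterS UA FU.
Qed.

Lemma weakstar_closure_inner_eq0 U T u v : linear T ->
  (forall S, U S -> linear S /\ '[S u, v] = 0) -> weakstar_closure U T -> '[T u, v] = 0.
Proof.
move=> lT US /weakstar_closureP[F [FF FU FT]].
pose p := weakstar_idx (@square_summable_single _ _ _ mu u) (@square_summable_single _ _ _ nu v).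
have pE S : linear S -> weakstar_pairing S p = '[S u, v].
  move=> lS; rewrite /weakstar_pairing /=; apply/cvg_lim => //.
  apply: cvg_near_cst.
  exists 1%N => // n /= n1; rewrite seriesEord /= -(prednK n1) big_ord_recl /=.
  by rewrite big1 ?addr0// => i _; rewrite inner0r.
rewrite -pE//.
have FT0 : (fun S => weakstar_pairing S p) @ F --> (0 : R[i]).
  apply: cvg_near_cst; apply: filterS FU => S /US[lS S0].
  by rewrite pE.
exact: (cvg_unique (@norm_hausdorff _ _) (FT p) FT0).
Qed.

End weakstar.

(** Weak* continuity of T |-> B' T A: since <B' T A xi_k, eta_k> = <T A xi_k, B eta_k>, a pairing of
    the compression is a pairing of T with the square summable sequences A xi_k and B eta_k. *)
Lemma weakstar_closure_transpose d1 d2 d3 d4 (X : measurableType d1) (Y : measurableType d2)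
    (X1 : measurableType d3) (Y1 : measurableType d4) (R : realType)
    (mu : {measure set X -> \bar R}) (nu : {measure set Y -> \bar R})
    (mu1 : {measure set X1 -> \bar R}) (nu1 : {measure set Y1 -> \bar R})
    (A : L2 mu1 -> L2 mu) (B : L2 nu1 -> L2 nu) B' (U : set (L2 mu -> L2 nu))
    (U1 : set (L2 mu1 -> L2 nu1)) T :
  bounded_op A -> bounded_op B -> is_adj B B' ->
  (forall S, U S -> U1 (B' \o S \o A)) ->
  weakstar_closure U T -> weakstar_closure U1 (B' \o T \o A).
Proof.
move=> bA bB BB' UU1 /weakstar_closureP[F [FF FU FT]].
apply/weakstar_closureP; exists (fmap (fun S : L2 mu -> L2 nu => B' \o S \o A) F); split.
- exact: fmap_proper_filter.
- exact: (filterS UU1 FU).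
move=> [[xi eta] /= [sxi seta]].
pose p := weakstar_idx (square_summable_comp bA sxi) (square_summable_comp bB seta).
have pE S : weakstar_pairing (B' \o S \o A) (weakstar_idx sxi seta) = weakstar_pairing S p.
  rewrite /weakstar_pairing /=; congr (lim (series _ @ \oo)); apply/funext => k.
  by rewrite (is_adjC BB').
rewrite -[exist _ _ _]/(weakstar_idx sxi seta) pE => W /(FT p) FW.
change (F (fun S => W (weakstar_pairing (B' \o S \o A) (weakstar_idx sxi seta)))).
by under eq_fun do rewrite pE.
Qed.

(** * Transfer of bimodules *)

(** Makes the adjoint of a multiplication operator usable in [intertwiner_comp] without identifying
    it as multiplication by the conjugate. *)
Lemma mulop_adj_comm d (Z : measurableType d) (R : realType) (la : {measure set Z -> \bar R})
    (phi : Z -> R[i]) (D : L2 la -> L2 la) :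
  cLfun la +oo%E phi -> is_adj (mulop phi) D ->
  forall A, measurable A -> forall u, D (mulop (cindic R A) u) = mulop (cindic R A) (D u).
Proof.
move=> pphi adjD A mA u.
apply: inner_ext => w; rewrite -adjD -(cindic_adj mA) -(cindic_adj mA) -adjD.
by rewrite mulop_comm//; exact: cLfun_cindic.
Qed.

Lemma measure0_setD_null d (X : measurableType d) (R : realType)
    (mu : {measure set X -> \bar R}) (A M K : set X) :
  measurable A -> measurable M -> measurable K ->
  mu ((A `\` M) `\` K) = 0%E -> mu M = 0%E -> mu (A `\` K) = 0%E.
Proof.
move=> mA mM mK AK M0; apply/eqP; rewrite eq_le measure_ge0 andbT.
have mAMK : measurable ((A `\` M) `\` K) by apply: measurableD => //; exact: measurableD.
apply: (@le_trans _ _ (mu (((A `\` M) `\` K) `|` M))).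
  apply: le_measure; rewrite ?inE; [exact: measurableD|exact: measurableU|].
  by move=> x [Ax nK]; have [?|?] := pselect (M x); [right|left].
apply: (le_trans (measureU2 _ _ _)) => //.
by rewrite [X in (X + _)%E]AK [X in (_ + X)%E]M0 adde0.
Qed.

Section intertwiner_algebra.
Context d (X : measurableType d) d1 (X1 : measurableType d1) (R : realType).
Variables (mu : {measure set X -> \bar R}) (mu1 : {measure set X1 -> \bar R}).
Variables (theta : X -> X1) (mtheta : measurable_fun setT theta).

Lemma intertwiner_adj (A : L2 mu1 -> L2 mu) A' B v : intertwiner theta A -> is_adj A A' ->
  measurable B -> A' (mulop (cindic R (theta @^-1` B)) v) = mulop (cindic R B) (A' v).
Proof.
move=> [_ AB] AA' mB; apply: inner_ext => w.
rewrite -AA' -(cindic_adj (measurable_preimageT mtheta mB)) -AB//.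
by rewrite AA' (cindic_adj mB).
Qed.

Lemma intertwiner_comp (A : L2 mu1 -> L2 mu) (C : L2 mu -> L2 mu) :
  intertwiner theta A -> bounded_op C ->
  (forall B, measurable B -> forall u, C (mulop (cindic R B) u) = mulop (cindic R B) (C u)) ->
  intertwiner theta (C \o A).
Proof.
move=> [bA AB] bC CB; split; first exact: bounded_op_comp.
by move=> B mB u; rewrite /= AB// CB//; exact: measurable_preimageT.
Qed.

End intertwiner_algebra.

(** * Closure properties of Mmax(sigma) and a duality criterion for Ref *)

Section Mmax_theory.
Context d1 d2 (X : measurableType d1) (Y : measurableType d2) (R : realType).
Variables (mu : {measure set X -> \bar R}) (nu : {measure set Y -> \bar R}).
Variable sigma : set (X * Y).
Local Notation op := (L2 mu -> L2 nu).

Lemma Mmax_bimodule : bimodule (Mmax mu nu sigma).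
Proof.
split.
- by move=> T [].
- split; first exact: bounded_op0.
  move=> a b ma mb _; apply/funext => u; change (mulop (cindic R b) (0 : L2 nu) = 0).
  by apply: linear_op0; have [] := cindic_bounded nu mb.
- move=> a S T [bS sS] [bT sT]; split; first exact: bounded_opZD.
  move=> A B mA mB AB; apply/funext => u.
  have lB : linear (mulop (cindic R B) : L2 nu -> L2 nu) by have [] := cindic_bounded nu mB.
  change (mulop (cindic R B) (a *: S (mulop (cindic R A) u) + T (mulop (cindic R A) u)) = 0).
  rewrite lB.
  have /(congr1 (fun f => f u)) /= -> := sS A B mA mB AB.
  have /(congr1 (fun f => f u)) /= -> := sT A B mA mB AB.
  by rewrite scaler0 addr0.
- move=> phi psi T pphi ppsi [bT sT]; split.
    apply: bounded_op_comp; last exact: mulop_bounded.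
    by apply: bounded_op_comp => //; exact: mulop_bounded.
  move=> A B mA mB AB; apply/funext => u /=.
  rewrite (mulop_comm _ pphi (cLfun_cindic mu mA)) (mulop_comm _ (cLfun_cindic nu mB) ppsi).
  have /(congr1 (fun f => f (mulop phi u))) /= -> := sT A B mA mB AB.
  by apply: linear_op0; exact: mulop_linear.
Qed.

(** Expresses the support by equations <T u, v> = 0, which pass to weak* limits. *)
Lemma supported_onP (T : op) : supported_on sigma T <->
  forall A B, measurable A -> measurable B ->
    marginally_equiv mu nu ((A `*` B) `&` sigma) set0 ->
    forall u v, '[T (mulop (cindic R A) u), mulop (cindic R B) v] = 0.
Proof.
split=> [sT A B mA mB AB u v|sT A B mA mB AB].
  rewrite -(cindic_adj mB).
  by have /(congr1 (fun f => f u)) /= -> := sT A B mA mB AB; rewrite inner0l.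
apply/funext => u; apply: inner_ext => v /=.
by rewrite innerC (cindic_adj mB) sT// inner0r rmorph0.
Qed.

Lemma Mmax_weakstar_closed : weakstar_closed (Mmax mu nu sigma).
Proof.
split=> [T []//|T [clT bT]]; split=> //.
apply/supported_onP => A B mA mB AB u v.
have [lT _] := bT.
apply: (weakstar_closure_inner_eq0 lT _ clT) => S [[lS _] /supported_onP sS].
by split=> //; exact: sS.
Qed.

Lemma sub_Ref (U : set op) : U `<=` @bounded_op _ _ _ -> U `<=` Ref U.
Proof.
move=> Ub T UT; split; first exact: Ub.
by move=> xi; apply: subset_closure; apply: sub_lin_span; exists T.
Qed.

Lemma Ref_inner_eq0 (U : set op) T u v : Ref U T -> (forall S, U S -> '[S u, v] = 0) ->
  '[T u, v] = 0.
Proof.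
move=> [_ /(_ u)] clT US; apply: (closure_inner_eq0 _ clT) => k kU.
have sub : submodule [set w : L2 nu | '[w, v] = 0].
  split; first exact: inner0l.
  by move=> a w z /= w0 z0; rewrite innerDl innerZl w0 z0 mulr0 addr0.
by apply: (lin_span_min sub _ kU) => _ [S /US S0 <-].
Qed.

(** Let p be the projection of T u onto the closed span of U u. The residual T u - p is orthogonal
    to U u, hence to T u by hypothesis and to p, so it is 0. *)
Lemma RefP (U : set op) T : bounded_op T ->
  (forall u v, (forall S, U S -> '[S u, v] = 0) -> '[T u, v] = 0) -> Ref U T.
Proof.
move=> bT UT; split=> // u.
have [p clp pK] := projection (lin_span_submodule [set S u | S in U]) (T u).
suff -> : T u = p by [].
have z S : U S -> '[S u, T u - p] = 0.
  move=> US; rewrite innerC pK ?rmorph0//.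
  by apply: sub_lin_span; exists S.
apply/eqP; rewrite -subr_eq0; apply/eqP/inner_eq0.
rewrite innerBl UT// sub0r (closure_inner_eq0 _ clp) ?oppr0// => k Kk.
by rewrite innerC pK// rmorph0.
Qed.

End Mmax_theory.

(* Stands in for the measurability of the analytic set theta (A). *)
Definition measurable_image_cover d (X : measurableType d) d1 (X1 : measurableType d1)
    (R : realType) (mu : set X -> \bar R) (theta : X -> X1) :=
  forall A, measurable A -> exists K : nat -> set X, [/\ forall n, measurable (K n),
    forall n, K n `<=` A, forall n, measurable (theta @` K n) &
    mu (A `\` \bigcup_n K n) = 0%E].

(** * Compression from X x Y to X1 x Y1 and dilation back *)

Section transfer_bimodule.
Context d1 d2 d3 d4 (X : measurableType d1) (Y : measurableType d2)
  (X1 : measurableType d3) (Y1 : measurableType d4) (R : realType).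
Variables (mu : {sigma_finite_measure set X -> \bar R}).
Variables (nu : {sigma_finite_measure set Y -> \bar R}).
Variables (mu1 : {sigma_finite_measure set X1 -> \bar R}).
Variables (nu1 : {sigma_finite_measure set Y1 -> \bar R}).
Variables (theta : X -> X1) (mtheta : measurable_fun setT theta).
Variables (rho : Y -> Y1) (mrho : measurable_fun setT rho).
Hypothesis theta_ac : pushforward mu theta `<< mu1.
Hypothesis rho_ac : pushforward nu rho `<< nu1.
Hypothesis theta_cover : measurable_image_cover mu theta.
Hypothesis rho_cover : measurable_image_cover nu rho.
Variable E1 : set (X1 * Y1).
Local Notation E := ([set p | E1 (theta p.1, rho p.2)] : set (X * Y)).

(** The intertwining relations replace a rectangle by its preimage, and absolute continuity makes
    the preimage of a marginally null set marginally null. *)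
Lemma Mmax_compress T A B B' : Mmax mu nu E T -> intertwiner theta A ->
  intertwiner rho B -> is_adj B B' -> Mmax mu1 nu1 E1 (B' \o T \o A).
Proof.
move=> [bT sT] tA tB BB'; have [bA _] := tA; have [bB _] := tB.
have bB' := is_adj_bounded bB BB'.
split; first by apply: bounded_op_comp => //; exact: bounded_op_comp.
move=> a b ma mb [M1 [M2 [mM1 M10 mM2 M20 sub]]].
have mpa := measurable_preimageT mtheta ma.
have mpb := measurable_preimageT mrho mb.
have ab : marginally_equiv mu nu (((theta @^-1` a) `*` (rho @^-1` b)) `&` E) set0.
  exists (theta @^-1` M1), (rho @^-1` M2); split.
  - exact: measurable_preimageT.
  - exact: pushforward_null theta_ac _ mM1 M10.
  - exact: measurable_preimageT.
  - exact: pushforward_null rho_ac _ mM2 M20.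
  move=> [x y] [[[[/= ax by_] Exy] _]|[]//].
  have [|[m _]|[_ m]] := sub (theta x, rho y).
  - by left; split.
  - by left.
  - by right.
apply/funext => u /=; have [_ AB] := tA; rewrite AB//.
rewrite -(intertwiner_adj mrho _ tB BB' mb).
have /(congr1 (fun f => f (A u))) /= -> := sT _ _ mpa mpb ab.
by apply: linear_op0; have [] := bB'.
Qed.

(** The images of a and b under theta and rho may fail to be measurable, so a and b, with the
    exceptional null sets M1 and M2 removed, are exhausted by pieces [K n] and [L m] with measurable
    images. *)
Lemma Mmax_dilate S A A' B : Mmax mu1 nu1 E1 S -> intertwiner theta A ->
  is_adj A A' -> intertwiner rho B -> Mmax mu nu E (B \o S \o A').
Proof.
move=> [bS sS] tA AA' tB; have [bA _] := tA; have [bB BB] := tB.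
have bA' := is_adj_bounded bA AA'.
have bZ : bounded_op (B \o S \o A').
  by apply: bounded_op_comp => //; exact: bounded_op_comp.
split=> // a b ma mb [M1 [M2 [mM1 M10 mM2 M20 sub]]].
have [K [mK Ka mtK aK]] := theta_cover (measurableD ma mM1).
have [L [mL Lb mrL bL]] := rho_cover (measurableD mb mM2).
have aK0 : mu (a `\` \bigcup_n K n) = 0%E.
  by apply: measure0_setD_null aK M10 => //; exact: bigcupT_measurable.
have bL0 : nu (b `\` \bigcup_n L n) = 0%E.
  by apply: measure0_setD_null bL M20 => //; exact: bigcupT_measurable.
have KL n m u : mulop (cindic R (L m)) (B (S (A' (mulop (cindic R (K n)) u)))) = 0.
  have mtn := measurable_preimageT mtheta (mtK n).
  have mrm := measurable_preimageT mrho (mrL m).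
  (* As K n is contained in theta^-1 (theta (K n)), the projection for the larger set can be
     inserted, and A' carries it to the projection for theta (K n). Likewise for L m and B. *)
  rewrite -(cindic_subset u (mK n) mtn (@preimage_image _ _ theta (K n))).
  rewrite -(cindic_subset _ (mL m) mrm (@preimage_image _ _ rho (L m))).
  rewrite (mulop_comm u (cLfun_cindic mu (mK n)) (cLfun_cindic mu mtn)).
  rewrite (intertwiner_adj mtheta _ tA AA' (mtK n)) -BB//.
  (* A point of this set would be the image of some (x, y) in (a x b) [&] E with x outside M1 and y
     outside M2, which [sub] excludes. *)
  have disj : marginally_equiv mu1 nu1
      (((theta @` K n) `*` (rho @` L m)) `&` E1) set0.
    exists set0, set0; split=> //.
    move=> [x1 y1] [[[[/= [x Kx <-] [y Ly <-]] Exy] _]|[]//].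
    have [ax nM1] := Ka _ _ Kx; have [bY nM2] := Lb _ _ Ly.
    by have [|[]//|[]//] := sub (x, y); left; split.
  have /(congr1 (fun f => f (A' (mulop (cindic R (K n)) u)))) /= -> :=
    sS _ _ (mtK n) (mrL m) disj.
  rewrite (linear_op0 (proj1 bB)).
  by apply: linear_op0; exact: (proj1 (cindic_bounded nu (mL m))).
(* [cindic_cover_eq0] cuts down output vectors; it reaches the set a, on the input side, through the
   adjoint. *)
have [Z' ZZ'] := adj_exists bZ.
have Lzero m u : mulop (cindic R (L m)) (B (S (A' (mulop (cindic R a) u)))) = 0.
  apply: inner_ext => v; rewrite inner0r -(cindic_adj (mL m)) innerC.
  rewrite -[B _]/((B \o S \o A') _) ZZ' (cindic_adj ma).
  rewrite (cindic_cover_eq0 ma mK aK0) ?inner0r ?rmorph0// => n.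
  apply: inner_ext => w; rewrite inner0r -(cindic_adj (mK n)) -ZZ' -(cindic_adj (mL m)).
  by rewrite KL inner0l.
apply/funext => u /=.
by apply: (cindic_cover_eq0 mb mL bL0).
Qed.

Definition pulled_bimodule (V1 : set (L2 mu1 -> L2 nu1)) : set (L2 mu -> L2 nu) :=
  [set T | Mmax mu nu E T /\ forall A B B', intertwiner theta A -> intertwiner rho B ->
     is_adj B B' -> V1 (B' \o T \o A)].

(** Compressing the dilation surrounds S by B2' B and A' A2. Both commute with characteristic
    functions, so by [masa] they are multiplications and the bimodule property applies. *)
Lemma dilate_pulled V1 S A A' B : bimodule V1 -> V1 `<=` Mmax mu1 nu1 E1 -> V1 S ->
  intertwiner theta A -> is_adj A A' -> intertwiner rho B ->
  pulled_bimodule V1 (B \o S \o A').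
Proof.
move=> [_ _ _ modV1] V1M V1S tA AA' tB.
split; first exact: Mmax_dilate (V1M _ V1S) tA AA' tB.
move=> A2 B2 B2' tA2 tB2 BB2.
have [bA AB] := tA; have [bB BB] := tB; have [bA2 A2B] := tA2; have [bB2 B2B] := tB2.
have [|C mC u|phi pphi Hphi] := @masa _ _ _ mu1 (A' \o A2).
- exact: bounded_op_comp (is_adj_bounded bA AA') bA2.
- by rewrite /= A2B// (intertwiner_adj mtheta _ tA AA' mC).
have [|C mC u|psi ppsi Hpsi] := @masa _ _ _ nu1 (B2' \o B).
- exact: bounded_op_comp (is_adj_bounded bB2 BB2) bB.
- by rewrite /= BB// (intertwiner_adj mrho _ tB2 BB2 mC).
have -> : B2' \o (B \o S \o A') \o A2 = mulop psi \o S \o mulop phi.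
  by apply/funext => u /=; rewrite -Hphi -Hpsi.
exact: modV1.
Qed.

Lemma pulled_Ref_family V1 : Ref_family (Mmax mu1 nu1 E1) V1 ->
  Ref_family (Mmax mu nu E) (pulled_bimodule V1).
Proof.
move=> [[V1b V1cl] V1bim V1M RefV1]; have [_ V10 V1lin V1mod] := V1bim.
have VM : pulled_bimodule V1 `<=` Mmax mu nu E by move=> T [].
have [Mb M0 Mlin Mmod] := Mmax_bimodule mu nu E.
have [_ Mcl] := Mmax_weakstar_closed mu nu E.
split=> //.
- split=> [T /VM/Mb//|T [clT bT]]; split.
    by apply: Mcl; split=> //; apply: (closure_subset _ clT); exact: VM.
  move=> A B B' tA tB BB'; have [bA _] := tA; have [bB _] := tB.
  apply: V1cl; split; last first.
    apply: bounded_op_comp bA; apply: bounded_op_comp bT.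
    exact: is_adj_bounded BB'.
  apply: (weakstar_closure_transpose (U := pulled_bimodule V1) bA bB BB' _ clT).
  by move=> S [_ VS]; exact: (VS _ _ _ tA tB BB').
- split.
  + by move=> T /VM/Mb.
  + split=> // A B B' tA tB BB'; have [lB' _] := is_adj_bounded (proj1 tB) BB'.
    rewrite (_ : _ \o _ = 0)//; apply/funext => u.
    by change (B' 0 = 0); exact: linear_op0.
  + move=> a S T [MS VS] [MT VT]; split; first exact: Mlin.
    move=> A B B' tA tB BB'; have [lB' _] := is_adj_bounded (proj1 tB) BB'.
    rewrite (_ : _ \o _ = a *: (B' \o S \o A) + (B' \o T \o A)).
      by apply: V1lin; [exact: (VS _ _ _ tA tB BB')|exact: (VT _ _ _ tA tB BB')].
    by apply/funext => u; exact: lB'.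
  + move=> phi psi T pphi ppsi [MT VT]; split; first exact: Mmod.
    move=> A B B' tA tB BB'.
    have [D adjD] := adj_exists (mulop_bounded ppsi).
    (* The two multiplications are absorbed into the intertwiners; D is the adjoint of [mulop psi],
       so D B has adjoint B' M_psi. *)
    apply: (VT (mulop phi \o A) (D \o B) (B' \o mulop psi)).
    * apply: intertwiner_comp => //; first exact: mulop_bounded.
      by move=> C mC v; rewrite mulop_comm//; exact: cLfun_cindic.
    * apply: intertwiner_comp => //; first exact: is_adj_bounded (mulop_bounded ppsi) adjD.
      exact: mulop_adj_comm ppsi adjD.
    * by move=> u v /=; rewrite (is_adjC adjD) BB'.
apply/seteqP; split=> T [bT RT].
  split=> // u; apply: closure_subset (RT u).
  apply: lin_span_min; first exact: lin_span_submodule.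
  by move=> _ [S VS <-]; apply: sub_lin_span; exists S => //; exact: VM.
apply: RefP => // u v uv0.
apply: (Ref_inner_eq0 (conj bT RT)) => S MS.
have [A [f [tA Af A'f]]] := intertwiner_exists mtheta theta_ac u.
have [B [g [tB Bg B'g]]] := intertwiner_exists mrho rho_ac v.
have [A' AA'] := adj_exists (proj1 tA).
have [B' BB'] := adj_exists (proj1 tB).
rewrite -Af -Bg innerC BB' -innerC.
have MS1 := Mmax_compress MS tA tB BB'.
have RS1 : Ref V1 (B' \o S \o A).
  by rewrite RefV1; apply: sub_Ref MS1 => ? [].
(* Since f = A' u and g = B' v, <S1 f, g> equals <B S1 A' u, v>, and B S1 A' is in the pulled
   bimodule, where [uv0] applies. *)
apply: (Ref_inner_eq0 RS1) => S1 V1S1.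
rewrite -(A'f _ AA') -(B'g _ BB') -BB'.
by apply: (uv0 (B \o S1 \o A')); exact: (dilate_pulled V1bim V1M V1S1 tA AA' tB).
Qed.

(** Mmin(E) is an intersection, and each V1 competing for Mmin(E1) pulls back to a competitor for
    Mmin(E); T is in that pullback, so its compression is in V1. *)
Lemma Mmin_compress T A B B' : Mmin mu nu E T -> intertwiner theta A ->
  intertwiner rho B -> is_adj B B' -> Mmin mu1 nu1 E1 (B' \o T \o A).
Proof.
move=> MT tA tB BB' V1 /pulled_Ref_family RV.
by have [_ H] := MT _ RV; exact: (H _ _ _ tA tB BB').
Qed.

(** With T xi nonzero, A f = xi and B g = T xi, one gets <B' T A f, g> = <T xi, T xi>. *)
Lemma compress_neq0 (T : L2 mu -> L2 nu) : T <> 0 ->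
  exists (A : L2 mu1 -> L2 mu) (B : L2 nu1 -> L2 nu) (B' : L2 nu -> L2 nu1),
  [/\ intertwiner theta A, intertwiner rho B, is_adj B B' & B' \o T \o A <> 0].
Proof.
move=> T0.
have [xi Txi] : exists xi, T xi <> 0.
  by apply: contrapT => /forallNP h; apply: T0; apply/funext => x; exact: contrapT (h x).
have [A [f [tA Af _]]] := intertwiner_exists mtheta theta_ac xi.
have [B [g [tB Bg _]]] := intertwiner_exists mrho rho_ac (T xi).
have [B' BB'] := adj_exists (proj1 tB).
exists A, B, B'; split=> // /(congr1 (fun S => '[S f, g])).
rewrite /= innerC -BB' -innerC Af Bg => TT0; apply/Txi/inner_eq0; rewrite TT0.
exact: inner0l.
Qed.

End transfer_bimodule.

(** * Compact, finite rank and rank 1 operators under two-sided multiplication *)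

Lemma bounded_op_continuous (R : realType)
    d1 (T1 : measurableType d1) (m1 : {measure set T1 -> \bar R})
    d2 (T2 : measurableType d2) (m2 : {measure set T2 -> \bar R}) (B : L2 m1 -> L2 m2) :
  bounded_op B -> continuous B.
Proof.
move=> /bounded_opP[lB [M M0 BM]].
move=> x W /nbhs_ballP[e /= e0 eW]; have [e1 eE] := gt0_complexE e0.
apply/nbhs_ballP; exists (complex.Re e / M)%:C%C; first by rewrite /= ltcR divr_gt0.
move=> y; rewrite -ball_normE /= hnormE ltcR ltr_pdivlMr// mulrC => xy.
apply: eW; rewrite -ball_normE /= -(linear_opB lB) hnormE eE ltcR.
exact: le_lt_trans (BM _) xy.
Qed.

Section compression_ideals.
Context (R : realType).
Context d1 (T1 : measurableType d1) (m1 : {measure set T1 -> \bar R}).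
Context d2 (T2 : measurableType d2) (m2 : {measure set T2 -> \bar R}).
Context d3 (T3 : measurableType d3) (m3 : {measure set T3 -> \bar R}).
Context d4 (T4 : measurableType d4) (m4 : {measure set T4 -> \bar R}).
Variables (A : L2 m1 -> L2 m2) (T : L2 m2 -> L2 m3) (B : L2 m3 -> L2 m4).
Hypotheses (bA : bounded_op A) (bB : bounded_op B).

Lemma bounded_op_compress : bounded_op T -> bounded_op (B \o T \o A).
Proof. by move=> bT; apply: bounded_op_comp => //; exact: bounded_op_comp. Qed.

Lemma compact_op_compress : compact_op T -> compact_op (B \o T \o A).
Proof.
move=> [bT cT]; split; first exact: bounded_op_compress.
have /bounded_opP[lA [M M0 AM]] := bA; have [[lT _] [lB _]] := (bT, bB).
(* A maps the unit ball into M times the unit ball; the factor M is moved to B, so the image of the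
   unit ball lies in h of a compact set. The term 0 gives h the form of [bounded_opZD]. *)
pose h := M%:C%C *: B + 0.
have hE y : h y = M%:C%C *: B y by rewrite /h; change (M%:C%C *: B y + 0 = M%:C%C *: B y); rewrite addr0.
have bh : bounded_op h by apply: bounded_opZD => //; exact: bounded_op0.
have ch : compact (h @` closure (T @` [set u | `|u| <= 1])).
  apply: continuous_compact => //; apply: continuous_subspaceT => y.
  exact: bounded_op_continuous.
have clh : closed (h @` closure (T @` [set u | `|u| <= 1])).
  by apply: compact_closed => //; exact: norm_hausdorff.
apply: (subclosed_compact (@closed_closure _ _) ch).
rewrite [X in _ `<=` X]((closure_id _).1 clh); apply: closure_subset => _ [u u1 <-].
exists (T (M^-1%:C%C *: A u)).
  apply: subset_closure; exists (M^-1%:C%C *: A u) => //=.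
  move: u1; rewrite /= !hnormE (_ : 1 = 1%:C%C :> R[i])// !lecR hnormZ.
  rewrite cabs_real => [u1|]; last by rewrite invr_ge0 ltW.
  by rewrite ler_pdivrMl// mulr1 (le_trans (AM u))// ler_piMr// ltW.
by rewrite hE (linear_opZ lT) (linear_opZ lB) scalerA -rmorphM divff ?gt_eqF// scale1r.
Qed.

Lemma finite_rank_op_compress : finite_rank_op T -> finite_rank_op (B \o T \o A).
Proof.
move=> [bT [n [w Tw]]]; split; first exact: bounded_op_compress.
have [lB _] := bB.
exists n, (B \o w) => u; have [c Tc] := Tw (A u); exists c.
by rewrite /= Tc (linear_op_sum lB).
Qed.

(** The range lies in the line spanned by B w, and being a nonzero subspace it is the whole line. *)
Lemma rank_one_op_compress : rank_one_op T -> B \o T \o A <> 0 -> rank_one_op (B \o T \o A).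
Proof.
move=> [bT [w w0 rT]] BTA0; split; first exact: bounded_op_compress.
have [lB _] := bB; have [lBTA _] := bounded_op_compress bT.
have BTAE u : exists c, B (T (A u)) = c *: B w.
  have [c _ cE] : [set c *: w | c in setT] (T (A u)) by rewrite -rT; exists (A u).
  by exists c; rewrite -cE (linear_opZ lB).
have [u u0] : exists u, B (T (A u)) <> 0.
  by apply: contrapT => /forallNP h; apply: BTA0; apply/funext => x; exact: contrapT (h x).
have [c cE] := BTAE u.
have c0 : c != 0 by apply/eqP => c0; apply: u0; rewrite cE c0 scale0r.
exists (B w); first by apply/eqP => Bw; apply: u0; rewrite cE Bw scaler0.
apply/seteqP; split=> [_ [x _ <-]|_ [a _ <-]].
  by have [b bE] := BTAE x; exists b.
exists ((a / c) *: u) => //.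
by rewrite (linear_opZ lBTA) /= cE scalerA divfK.
Qed.

Lemma rank_one_op_neq0 : rank_one_op T -> T <> 0.
Proof.
move=> [_ [w w0 rT]] T0; move/eqP : w0; apply.
have [x _ <-] : range T w by rewrite rT; exists 1 => //; rewrite scale1r.
by rewrite T0.
Qed.

End compression_ideals.

(** * Transfer of compact, finite rank and rank 1 operators *)

Theorem theorem5p3 (R : realType) (X Y X1 Y1 : completeMetricType R)
    (mu : {sigma_finite_measure set (borel X) -> \bar R})
    (nu : {sigma_finite_measure set (borel Y) -> \bar R})
    (mu1 : {sigma_finite_measure set (borel X1) -> \bar R})
    (nu1 : {sigma_finite_measure set (borel Y1) -> \bar R})
    (std_mu : standard_measure mu) (std_nu : standard_measure nu)
    (std_mu1 : standard_measure mu1) (std_nu1 : standard_measure nu1)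
    (theta : borel X -> borel X1) (rho : borel Y -> borel Y1)
    (mtheta : measurable_fun [set: borel X] theta)
    (mrho : measurable_fun [set: borel Y] rho)
    (theta_ac : pushforward mu theta `<< mu1)
    (rho_ac : pushforward nu rho `<< nu1)
    (E1 : set (borel X1 * borel Y1)) (mE1 : measurable E1) :
  let E : set (borel X * borel Y) := [set p | E1 (theta p.1, rho p.2)] in
  (((exists T, [/\ Mmax mu nu E T, compact_op T & T <> 0]) ->
     exists T1, [/\ Mmax mu1 nu1 E1 T1, compact_op T1 & T1 <> 0]) /\
   ((exists T, [/\ Mmax mu nu E T, finite_rank_op T & T <> 0]) ->
     exists T1, [/\ Mmax mu1 nu1 E1 T1, finite_rank_op T1 & T1 <> 0]) /\
   ((exists T, Mmax mu nu E T /\ rank_one_op T) ->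
     exists T1, Mmax mu1 nu1 E1 T1 /\ rank_one_op T1)) /\
  (((exists T, [/\ Mmin mu nu E T, compact_op T & T <> 0]) ->
     exists T1, [/\ Mmin mu1 nu1 E1 T1, compact_op T1 & T1 <> 0]) /\
   ((exists T, [/\ Mmin mu nu E T, finite_rank_op T & T <> 0]) ->
     exists T1, [/\ Mmin mu1 nu1 E1 T1, finite_rank_op T1 & T1 <> 0]) /\
   ((exists T, Mmin mu nu E T /\ rank_one_op T) ->
     exists T1, Mmin mu1 nu1 E1 T1 /\ rank_one_op T1)).

Proof.
have [sepX rmu] := std_mu; have [sepY rnu] := std_nu.
have [sepX1 _] := std_mu1; have [sepY1 _] := std_nu1.
move=> E.
have ctheta : measurable_image_cover mu theta.
  by move=> A mA; exact: (lusin_cover rmu sepX1 mtheta).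
have crho : measurable_image_cover nu rho.
  by move=> A mA; exact: (lusin_cover rnu sepY1 mrho).
(* In all six cases T1 is the nonzero compression B' T A given by [ex]. *)
have ex := compress_neq0 mtheta mrho theta_ac rho_ac.
have maxE T A B B' := @Mmax_compress _ _ _ _ _ _ _ _ _ mu nu mu1 nu1
  theta mtheta rho mrho theta_ac rho_ac E1 T A B B'.
have minE T A B B' := @Mmin_compress _ _ _ _ _ _ _ _ _ mu nu mu1 nu1
  theta mtheta rho mrho theta_ac rho_ac ctheta crho E1 T A B B'.
split; [split; [|split]|split; [|split]].
- move=> [T [MT cT T0]]; have [A [B [B' [tA tB BB' T10]]]] := ex T T0.
  exists (B' \o T \o A); split=> //; first exact: maxE MT tA tB BB'.
  exact: compact_op_compress (proj1 tA) (is_adj_bounded (proj1 tB) BB') cT.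
- move=> [T [MT fT T0]]; have [A [B [B' [tA tB BB' T10]]]] := ex T T0.
  exists (B' \o T \o A); split=> //; first exact: maxE MT tA tB BB'.
  exact: finite_rank_op_compress (proj1 tA) (is_adj_bounded (proj1 tB) BB') fT.
- move=> [T [MT rT]].
  have [A [B [B' [tA tB BB' T10]]]] := ex T (rank_one_op_neq0 rT).
  exists (B' \o T \o A); split; first exact: maxE MT tA tB BB'.
  exact: rank_one_op_compress (proj1 tA) (is_adj_bounded (proj1 tB) BB') rT T10.
- move=> [T [MT cT T0]]; have [A [B [B' [tA tB BB' T10]]]] := ex T T0.
  exists (B' \o T \o A); split=> //; first exact: minE MT tA tB BB'.
  exact: compact_op_compress (proj1 tA) (is_adj_bounded (proj1 tB) BB') cT.
- move=> [T [MT fT T0]]; have [A [B [B' [tA tB BB' T10]]]] := ex T T0.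
  exists (B' \o T \o A); split=> //; first exact: minE MT tA tB BB'.
  exact: finite_rank_op_compress (proj1 tA) (is_adj_bounded (proj1 tB) BB') fT.
- move=> [T [MT rT]].
  have [A [B [B' [tA tB BB' T10]]]] := ex T (rank_one_op_neq0 rT).
  exists (B' \o T \o A); split; first exact: minE MT tA tB BB'.
  exact: rank_one_op_compress (proj1 tA) (is_adj_bounded (proj1 tB) BB') rT T10.
Qed.
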